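(* Let $f \in L^2(\mathbb{R})$ (complex-valued) be arbitrary, and let $F = \mathcal{F}\{f\}$ be its Fourier transform. Define $$h(t) = \sqrt{2\pi}\cdot \mathscr{E}\{f\}(t) + \mathscr{E}\{F\}(t).$$ Then $h$ is invariant (shape-preserving) under the Fourier transform; precisely, its Fourier transform $H = \mathcal{F}\{h\}$ satisfies $H(\omega) = \sqrt{2\pi}\cdot h(\omega)$.
   Context: The Fourier transform is $\mathcal{F}\{f\}(\omega) = F(\omega) = \int_{-\infty}^{\infty} f(t) e^{-j\omega t}\,dt$ with $j^2=-1$, extended to $L^2(\mathbb{R})$ in the usual (Plancherel) way; equalities of $L^2$ functions hold almost everywhere. For a function $g$, $\mathscr{E}\{g\}(t) = \tfrac12\left(g(t)+g(-t)\right)$ denotes its even part. A function is called invariant under the Fourier transform if its Fourier transform is a scalar multiple of the function itself. *)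

(* Defs.v *)
From HB Require Import structures.
From mathcomp Require Import all_boot all_order all_algebra.
From mathcomp Require Import complex.
From mathcomp Require Import all_classical all_reals all_analysis.

Set Implicit Arguments.
Unset Strict Implicit.
Unset Printing Implicit Defensive.

Import Order.TTheory GRing.Theory Num.Theory.
Import numFieldNormedType.Exports.

Local Open Scope classical_set_scope.
Local Open Scope ring_scope.
Local Open Scope complex_scope.

Section FourierL2.
Context {R : realType}.
Local Notation mu := (@lebesgue_measure R).
Implicit Types (f g h F : R -> R[i]) (p : \bar R).

Definition cLnorm p f : \bar R :=
  Lnorm mu p (fun t => (Normc.normc (f t))%:E).

Definition cLfun p f : Prop :=
  [/\ measurable_fun setT (fun t => complex.Re (f t)),
      measurable_fun setT (fun t => complex.Im (f t)) &
      (cLnorm p f < +oo)%E].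

Definition cintegral f : R[i] :=
  Rintegral mu setT (fun t => complex.Re (f t)) +i*
  Rintegral mu setT (fun t => complex.Im (f t)).

Definition cexp (z : R[i]) : R[i] :=
  (expR (complex.Re z) * cos (complex.Im z)) +i*
  (expR (complex.Re z) * sin (complex.Im z)).

(* Meaningful for f in L^1 only. *)
Definition fourier1 f (omega : R) : R[i] :=
  cintegral (fun t => f t * cexp (- ('i * omega%:C * t%:C))).

(* F is the value at f of the extension of fourier1 by L^2-continuity from the
   dense subspace L^1 `&` L^2 to L^2.  For f in L^2 the approximating sequences
   g always exist (e.g. the truncations of f to [-n, n]), and F is determined
   up to a.e. equality. *)
Definition is_fourier f F : Prop :=
  [/\ cLfun 2%:E f, cLfun 2%:E F &
      forall g : nat -> R -> R[i],
        (forall n, cLfun 1 (g n) /\ cLfun 2%:E (g n)) ->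
        cLnorm 2%:E (g n \- f) @[n --> \oo] --> 0%E ->
        cLnorm 2%:E (fourier1 (g n) \- F) @[n --> \oo] --> 0%E].

(* A representative of the L^2 Fourier transform of f; the default value is
   only reached when f is not in L^2. *)
Definition fourier f : R -> R[i] := xget (fun=> 0) (is_fourier f).

Definition even_part g (t : R) : R[i] := 2^-1 * (g t + g (- t)).

Definition fourier_invariant h : Prop :=
  exists c : R[i], fourier h = (fun omega => c * h omega) %[ae mu].

End FourierL2.

(* Main.v *)
Require Import Defs.
From HB Require Import structures.
From mathcomp Require Import all_boot all_order all_algebra.
From mathcomp Require Import complex.
From mathcomp Require Import all_classical all_reals all_analysis.
From mathcomp Require Import measurable_realfun.
From mathcomp Require Import ring lra.

Set Implicit Arguments.
Unset Strict Implicit.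
Unset Printing Implicit Defensive.

Import Order.TTheory GRing.Theory Num.Theory.
Import numFieldNormedType.Exports.

Local Open Scope classical_set_scope.
Local Open Scope ring_scope.

(** The existence of the L^2 transform and its inversion are obtained by Abel
    summation.  The weight exp(-e|w|) has the Poisson kernel
    K_e(x) = 2e / (e^2 + x^2) as its Fourier transform.  By Fubini, for a in L^1,
    the integral of exp(-e|w|) |a^(w)|^2 is the quadratic form of K_e at a, which
    is at most 2 pi times the square norm of a; letting e tend to 0 gives the
    Plancherel inequality, hence (with completeness) a bounded transform on L^2.
    For g in L^1 and L^2 the transform of exp(-e|w|) g^(w) is x |-> (K_e * g)(-x).
    It converges in L^2 as e tends to 0, and its integrals over intervals tend to
    those of 2 pi g(-x); so the transform of g^ is 2 pi g(-x), and this extends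
    to L^2.  The transform therefore maps E{f} to E{F} and E{F} to 2 pi E{f},
    whence the theorem. *)

(** * Bounded kernels on L^1 *)

(** The definition of the transform quantifies over all approximating sequences, so even existence
    needs an L^2 bound; its constant does not matter, because the bound serves continuity only. The
    exact factor 2 pi comes from the inversion instead. The weight exp(-e|w|) is convenient because
    everything about it is elementary: its product with a cosine has an explicit primitive, and the
    Poisson kernel integrates to arctangents, whose limits pi/2 and -pi/2 yield the 2 pi. The
    convergence of the smoothed functions in L^2 is not proved by estimating the convolution: their
    limit exists because g^ has an L^2 transform, and it only has to be recognised. Integrals over
    intervals and Lebesgue differentiation do this. Applying the transform twice leaves a
    reflection, which even parts absorb; this is why h is built from even parts. *)

Section RealL1.
Context {R : realType}.
Local Notation mu := (@lebesgue_measure R).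
Implicit Types (a b w : R -> R) (k : R -> R -> R) (M : R).

Lemma integrable_measurable a :
  mu.-integrable setT (EFin \o a) -> measurable_fun setT a.
Proof. by case/integrableP => /measurable_EFinP. Qed.

Lemma integrableM_bounded a b M :
  mu.-integrable setT (EFin \o a) -> measurable_fun setT b ->
  (forall x, `|b x| <= M) -> mu.-integrable setT (EFin \o (fun x => a x * b x)).
Proof.
move=> ia mb bM.
have -> : EFin \o (fun x => a x * b x) = ((EFin \o a) \* (EFin \o b))%E.
  by apply/funext => x /=; rewrite EFinM.
apply: integrableMl => //; exists M; split; first exact: num_real.
by move=> y My x _; apply: le_trans (bM x) (ltW My).
Qed.

Lemma Rintegral_bounded a b M :
  mu.-integrable setT (EFin \o a) -> measurable_fun setT b ->
  (forall x, `|b x| <= M) ->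
  `|\int[mu]_x (a x * b x)| <= M * \int[mu]_x `|a x|.
Proof.
move=> ia mb bM.
apply: le_trans (le_normr_Rintegral _ _) _ => //; first exact: integrableM_bounded.
rewrite -RintegralZl//; last exact: integrable_norm.
apply: le_Rintegral => //.
- exact/integrable_norm/(integrableM_bounded ia mb bM).
- have -> : EFin \o (fun x => M * `|a x|) = (fun x => M%:E * (`|a x|)%:E)%E.
    by apply/funext => x /=; rewrite EFinM.
  by apply: integrableZl => //; exact: integrable_norm.
- by move=> x _; rewrite normrM mulrC ler_wpM2r.
Qed.

Lemma measurable_sections k : measurable_fun setT (fun z : R * R => k z.1 z.2) ->
  (forall x, measurable_fun setT (k x)) /\ (forall y, measurable_fun setT (k ^~ y)).
Proof.
move=> mk; split.
- by move=> x; exact: (measurable_fun_pair2 (f := fun z : R * R => k z.1 z.2)).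
- by move=> y; exact: (measurable_fun_pair1 (f := fun z : R * R => k z.1 z.2)).
Qed.

(** Tonelli's criterion: the integrand is dominated by M |w(x)| |a(y)|, a product of two L^1
    functions. *)
Lemma integrable_prod_bounded w a k M :
  mu.-integrable setT (EFin \o w) -> mu.-integrable setT (EFin \o a) ->
  measurable_fun setT (fun z : R * R => k z.1 z.2) -> (forall x y, `|k x y| <= M) ->
  (mu \x mu)%E.-integrable setT
    (fun z : R * R => (w z.1 * (a z.2 * k z.1 z.2))%:E).
Proof.
move=> iw ia mk kM.
have mw : measurable_fun setT w by exact: integrable_measurable.
have ma : measurable_fun setT a by exact: integrable_measurable.
have mf : measurable_fun setT (fun z : R * R => (w z.1 * (a z.2 * k z.1 z.2))%:E).
  apply/measurable_EFinP/measurable_funM; first exact: measurableT_comp mw measurable_fst.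
  apply: measurable_funM; last exact: mk.
  exact: measurableT_comp ma measurable_snd.
apply/(@integrable12ltyP _ _ _ _ R mu mu _ mf).
have M0 : 0 <= M by apply: le_trans (kM 0 0).
apply: (@le_lt_trans _ _ (\int[mu]_x (`|w x| * (M * \int[mu]_y `|a y|))%:E)%E).
  apply: ge0_le_integral => //.
  - by move=> x _; exact: integral_ge0.
  - apply: (@measurable_fun_fubini_tonelli_F _ _ _ _ R mu (abse \o (fun z : R * R =>
      (w z.1 * (a z.2 * k z.1 z.2))%:E))) => //=.
    exact: measurableT_comp.
  - by apply/measurable_EFinP/measurable_funM => //; exact: measurableT_comp.
  - move=> x _.
    have -> : (\int[mu]_x `|a x| = fine (\int[mu]_x `|(a x)%:E|)%E) by [].
    rewrite !EFinM fineK; last first.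
      by rewrite ge0_fin_numE ?integral_ge0//; case/integrableP: ia.
    rewrite muleA -EFinM -ge0_integralZl//; first last.
    - by rewrite lee_fin mulr_ge0.
    - by apply: measurableT_comp => //; exact/measurable_EFinP.
    apply: ge0_le_integral => //=.
    - apply/measurable_EFinP/measurableT_comp => //.
      apply: measurable_funM => //; apply: measurable_funM => //.
      by have [+ _] := measurable_sections mk; apply.
    - by apply/measurable_EFinP/measurable_funM => //; exact: measurableT_comp.
    - move=> y _; rewrite lee_fin !normrM -mulrA ler_wpM2l// mulrC.
      by rewrite ler_wpM2r.
have iw' : mu.-integrable setT (fun x => (`|w x| * (M * \int[mu]_y `|a y|))%:E).
  apply: (@integrableM_bounded (fun x => `|w x|)
    (cst (M * \int[mu]_y `|a y|)) (Num.norm (M * \int[mu]_y `|a y|))) => //.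
  exact: integrable_norm.
by apply: integrable_lty.
Qed.

(** The form in which Fubini is applied to the transforms: [w] is the Abel weight or the indicator
    of an interval, [a] a component of the signal, and [k] a bounded oscillating or Poisson
    kernel. *)
Lemma Rintegral_exchange w a k M :
  mu.-integrable setT (EFin \o w) -> mu.-integrable setT (EFin \o a) ->
  measurable_fun setT (fun z : R * R => k z.1 z.2) -> (forall x y, `|k x y| <= M) ->
  \int[mu]_x (w x * \int[mu]_y (a y * k x y)) =
  \int[mu]_y (a y * \int[mu]_x (w x * k x y)).
Proof.
move=> iw ia mk kM.
have [mk1 mk2] := measurable_sections mk.
have ip := integrable_prod_bounded iw ia mk kM.
have iak x : mu.-integrable setT (EFin \o (fun y => a y * k x y)).
  by apply: (integrableM_bounded (M := M)) => //; exact: mk1.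
have iwk y : mu.-integrable setT (EFin \o (fun x => w x * k x y)).
  by apply: (integrableM_bounded (M := M)) => //; exact: mk2.
congr fine.
transitivity (\int[mu]_x \int[mu]_y (w x * (a y * k x y))%:E)%E.
  apply: eq_integral => x _.
  rewrite EFinM fineK; last by apply: integrable_fin_num => //; exact: iak.
  rewrite -integralZl//; last exact: iak.
rewrite (Fubini ip)/=.
apply: eq_integral => y _.
rewrite [RHS]EFinM fineK; last by apply: integrable_fin_num => //; exact: iwk.
rewrite -integralZl//; last exact: iwk.
by apply: eq_integral => x _; rewrite -EFinM; congr EFin; ring.
Qed.

End RealL1.

(** * The Abel weight and the Poisson kernel *)

Section Poisson.
Context {R : realType}.
Local Notation mu := (@lebesgue_measure R).
Implicit Types (e x y t : R).

Lemma is_derive_continuous (F f : R -> R) :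
  (forall x, is_derive x 1 F (f x)) -> continuous F.
Proof.
move=> dF x; apply: differentiable_continuous; apply/derivable1_diffP.
by have [] := dF x.
Qed.

Lemma FTC_segment (F f : R -> R) c d : c < d -> continuous f ->
  (forall x, is_derive x 1 F (f x)) ->
  (\int[mu]_(x in `[c, d]) (f x)%:E = (F d - F c)%:E)%E.
Proof.
move=> cd cf dF; have cF := is_derive_continuous dF.
rewrite (@continuous_FTC2 _ f F)//.
- exact: continuous_subspaceT.
- split.
  + by move=> x _; have [] := dF x.
  + exact/cvg_at_right_filter/cF.
  + exact/cvg_at_left_filter/cF.
- by move=> x _; rewrite derive1E; have [] := dF x.
Qed.

Lemma ge0_FTC_halfline (F f : R -> R) (l : R) :
  (forall x, 0 <= f x) -> continuous f ->
  (forall x, is_derive x 1 F (f x)) -> F x @[x --> +oo] --> l ->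
  (\int[mu]_(x in `[0%R, +oo[) (f x)%:E = (l - F 0)%:E)%E.
Proof.
move=> f0 cf dF Fl; have cF := is_derive_continuous dF.
rewrite (@ge0_continuous_FTC2y _ f F 0 l)//.
- exact: continuous_subspaceT.
- exact/cvg_at_right_filter/cF.
- by move=> x _; rewrite derive1E; have [] := dF x.
Qed.

Lemma ge0_integral_opp (f : R -> \bar R) : measurable_fun setT f ->
  (forall x, 0 <= f x)%E -> (\int[mu]_x f (- x)%R = \int[mu]_x f x)%E.
Proof.
move=> mf f0.
transitivity (\int[pushforward mu (-%R : _ -> measurableTypeR R)]_x f x)%E.
  by rewrite ge0_integral_pushforward//; exact: oppr_measurable.
by apply: eq_measure_integral => A mA _; exact: lebesgue_measureN.
Qed.

(** The positive and negative parts are reflected separately, so measurability suffices. *)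
Lemma Rintegral_opp (a : R -> R) : measurable_fun setT a ->
  \int[mu]_x a (- x) = \int[mu]_x a x.
Proof.
move=> ma; rewrite /Rintegral integralE [in RHS]integralE.
have := funepos_comp (EFin \o a) (-%R); rewrite /comp => ->.
have := funeneg_comp (EFin \o a) (-%R); rewrite /comp => ->.
rewrite (ge0_integral_opp (f := (EFin \o a)^\+%E))//; last first.
  by apply: measurable_funepos; exact/measurable_EFinP.
rewrite (ge0_integral_opp (f := (EFin \o a)^\-%E))//.
by apply: measurable_funeneg; exact/measurable_EFinP.
Qed.

Lemma integrable_opp (a : R -> R) : mu.-integrable setT (EFin \o a) ->
  mu.-integrable setT (EFin \o (fun x => a (- x))).
Proof.
move=> /integrableP[ma ia]; apply/integrableP; split.
  by apply: (measurableT_comp ma); exact: oppr_measurable.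
rewrite (ge0_integral_opp (f := fun x => `|(a x)%:E|%E))//.
exact: measurableT_comp.
Qed.

Definition abel e x : R := expR (- (e * `|x|)).
(** Normalised as the transform of the weight, hence with total mass 2 pi rather than 1. *)
Definition poisson e x : R := 2 * e / (e ^+ 2 + x ^+ 2).

Lemma abel_gt0 e x : 0 < abel e x. Proof. exact: expR_gt0. Qed.

Lemma abel_le1 e x : 0 <= e -> abel e x <= 1.
Proof. by move=> e0; rewrite -expR0 ler_expR oppr_le0 mulr_ge0. Qed.

Lemma continuous_abel e : continuous (abel e).
Proof.
move=> x; apply: continuous_comp; last exact: continuous_expR.
by apply: cvgN; apply: cvgMl_tmp; exact: norm_continuous.
Qed.

Lemma measurable_abel e : measurable_fun setT (abel e).
Proof. by apply: continuous_measurable_fun; exact: continuous_abel. Qed.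

Lemma poisson_den_gt0 e x : 0 < e -> 0 < e ^+ 2 + x ^+ 2.
Proof. by move=> e0; rewrite ltr_pwDl ?exprn_gt0// sqr_ge0. Qed.

Lemma poisson_ge0 e x : 0 < e -> 0 <= poisson e x.
Proof.
by move=> e0; rewrite /poisson divr_ge0 ?mulr_ge0 ?(ltW e0)// ltW// poisson_den_gt0.
Qed.

Lemma poisson_le e x : 0 < e -> `|poisson e x| <= 2 / e.
Proof.
move=> e0; rewrite ger0_norm ?poisson_ge0// /poisson.
rewrite ler_pdivrMr ?poisson_den_gt0// mulrAC ler_pdivlMr//.
by rewrite -!mulrA ler_pM2l// -expr2 lerDl sqr_ge0.
Qed.

Lemma poissonN e x : poisson e (- x) = poisson e x.
Proof. by rewrite /poisson sqrrN. Qed.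

Lemma continuous_poisson e : 0 < e -> continuous (poisson e).
Proof.
move=> e0 x; apply: cvgM; first exact: cvg_cst.
apply: cvgV; first by rewrite gt_eqF// poisson_den_gt0.
by apply: cvgD; [exact: cvg_cst|exact: exprn_continuous].
Qed.

Lemma is_derive_atan_scale e t x : 0 < e ->
  is_derive x 1 (fun x => 2 * atan (e^-1 * (t + x))) (poisson e (t + x)).
Proof.
move=> e0; have en0 : e != 0 by rewrite gt_eqF.
have -> : (fun x => 2 * atan (e^-1 * (t + x))) =
  cst 2 * (atan \o (cst e^-1 * (cst t + id))) by [].
apply: is_derive_eq.
rewrite /poisson !fctE/= /GRing.scale/=.
have dn0 : e ^+ 2 + (t + x) ^+ 2 != 0 by rewrite gt_eqF ?poisson_den_gt0.
have dn1 : 1 + (e^-1 * (t + x)) ^+ 2 != 0.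
  by rewrite gt_eqF// ltr_pwDl// sqr_ge0.
field.
by rewrite en0 dn0.
Qed.

Lemma cvg_expRN_scale e : 0 < e -> expR (- (e * x)) @[x --> +oo] --> (0 : R).
Proof.
move=> e0.
have -> : (fun x => expR (- (e * x))) = (fun x => expR (- x)) \o (fun x => x * e).
  by apply/funext => x /=; rewrite mulrC.
apply: cvg_comp; last exact: cvgr_expR.
by apply: gt0_cvgMly => //; exact: cvg_id.
Qed.

(** The real part of exp((-e + iy)x) / (-e + iy), plus -exp(-ex) / e for the summand 1: a primitive
    of exp(-ex) (1 + cos(yx)). *)
Definition abel_cos_prim e y x : R :=
  expR (- (e * x)) * ((e ^+ 2 + y ^+ 2)^-1 * (y * sin (y * x) - e * cos (y * x)) - e^-1).

Lemma is_derive_abel_cos_prim e y x : 0 < e ->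
  is_derive x 1 (abel_cos_prim e y) (expR (- (e * x)) * (1 + cos (y * x))).
Proof.
move=> e0; have en0 : e != 0 by rewrite gt_eqF.
have dn0 : e ^+ 2 + y ^+ 2 != 0 by rewrite gt_eqF ?poisson_den_gt0.
have -> : abel_cos_prim e y = (expR \o (- (cst e * id))) *
  (cst (e ^+ 2 + y ^+ 2)^-1 *
     (cst y * (sin \o (cst y * id)) - cst e * (cos \o (cst y * id))) - cst e^-1) by [].
apply: is_derive_eq.
rewrite !fctE/= /GRing.scale/=.
field.
by rewrite en0 dn0.
Qed.

Lemma abel_cos_prim_cvg e y : 0 < e ->
  abel_cos_prim e y x @[x --> +oo] --> (0 : R).
Proof.
move=> e0.
pose C := (e ^+ 2 + y ^+ 2)^-1 * (`|y| + `|e|) + e^-1.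
apply/norm_cvg0P.
apply: (@squeeze_cvgr _ _ _ _ (cst 0) (fun x => expR (- (e * x)) * C)).
- apply: nearW => x; rewrite normr_ge0/= /abel_cos_prim normrM.
  rewrite (ger0_norm (expR_ge0 _)) ler_wpM2l ?expR_ge0//.
  apply: le_trans (ler_normB _ _) _; rewrite (ger0_norm (x := e^-1)) ?invr_ge0 ?(ltW e0)//.
  rewrite lerD2r normrM ger0_norm ?invr_ge0 ?(ltW (poisson_den_gt0 _ e0))//.
  rewrite ler_wpM2l ?invr_ge0 ?(ltW (poisson_den_gt0 _ e0))//.
  apply: le_trans (ler_normB _ _) _; rewrite !normrM lerD// ler_piMr//.
  + by rewrite ler_norml sin_geN1 sin_le1.
  + by rewrite ler_norml cos_geN1 cos_le1.
- exact: cvg_cst.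
- by rewrite -[X in _ --> X](mul0r C); apply: cvgMr_tmp; exact: cvg_expRN_scale.
Qed.

Lemma cos_norm_le1 x : `|cos x| <= 1.
Proof. by rewrite ler_norml cos_geN1 cos_le1. Qed.

Lemma sin_norm_le1 x : `|sin x| <= 1.
Proof. by rewrite ler_norml sin_geN1 sin_le1. Qed.

Lemma continuous_scale (phi : R -> R) y : continuous phi ->
  continuous (fun x => phi (y * x)).
Proof.
move=> cphi x; apply: continuous_comp; last exact: cphi.
exact: mulrl_continuous.
Qed.

(* Adding 1 to the cosine makes the integrand nonnegative, so that the
   half-line fundamental theorem of calculus applies. *)
Lemma integral_abel_1Dcos e y : 0 < e ->
  (\int[mu]_x (abel e x * (1 + cos (y * x)))%:E = (2 / e + poisson e y)%:E)%E.
Proof.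
move=> e0; rewrite ge0_symfun_integralT; last 3 first.
- move=> x; rewrite mulr_ge0 ?(ltW (abel_gt0 _ _))//.
- move=> x; apply: cvgM; first exact: continuous_abel.
  by apply: cvgD; [exact: cvg_cst|apply: continuous_scale; exact: continuous_cos].
- by move=> x /=; rewrite /abel normrN mulrN cosN.
rewrite -set_itvcy.
under eq_integral => x.
  rewrite inE/= in_itv/= andbT => x0; rewrite /abel ger0_norm//.
  over.
transitivity (2%:E * (0 - abel_cos_prim e y 0)%:E)%E; last first.
  rewrite -EFinM; congr EFin; rewrite /abel_cos_prim !mulr0 oppr0 expR0 sin0 cos0 /poisson.
  have en0 : e != 0 by rewrite gt_eqF.
  have dn0 : e ^+ 2 + y ^+ 2 != 0 by rewrite gt_eqF ?poisson_den_gt0.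
  by field; rewrite en0 dn0.
congr (_ * _)%E.
apply: (@ge0_FTC_halfline _ (fun x => expR (- (e * x)) * (1 + cos (y * x)))).
- by move=> x; rewrite mulr_ge0 ?expR_ge0// -lerBlDl sub0r cos_geN1.
- move=> x; apply: cvgM; last first.
    by apply: cvgD; [exact: cvg_cst|apply: continuous_scale; exact: continuous_cos].
  apply: continuous_comp; last exact: continuous_expR.
  by apply: cvgN; exact: mulrl_continuous.
- by move=> x; exact: is_derive_abel_cos_prim.
- exact: abel_cos_prim_cvg.
Qed.

(** At y = 0 the integrand of [integral_abel_1Dcos] is twice the weight, so its finite integral
    dominates. *)
Lemma integrable_abel e : 0 < e -> mu.-integrable setT (EFin \o abel e).
Proof.
move=> e0; apply/integrableP; split; first by apply/measurable_EFinP; exact: measurable_abel.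
apply: (@le_lt_trans _ _ (\int[mu]_x (abel e x * (1 + cos (0 * x)))%:E)%E); last first.
  by rewrite integral_abel_1Dcos// ltry.
apply: ge0_le_integral => //.
- by apply/measurable_EFinP/measurableT_comp => //; exact: measurable_abel.
- apply/measurable_EFinP/measurable_funM; first exact: measurable_abel.
  apply: measurable_funD => //.
  by apply: continuous_measurable_fun; apply: continuous_scale; exact: continuous_cos.
- move=> x _ /=; rewrite lee_fin mul0r cos0 ger0_norm ?(ltW (abel_gt0 _ _))//.
  by rewrite ler_peMr ?(ltW (abel_gt0 _ _))// lerDl.
Qed.

Lemma integrable_abel_cos e y : 0 < e ->
  mu.-integrable setT (EFin \o (fun x => abel e x * cos (y * x))).
Proof.
move=> e0; apply: (integrableM_bounded (M := 1)); first exact: integrable_abel.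
- by apply: continuous_measurable_fun; apply: continuous_scale; exact: continuous_cos.
- by move=> x; exact: cos_norm_le1.
Qed.

Lemma Rintegral_abel_cos e y : 0 < e ->
  \int[mu]_x (abel e x * cos (y * x)) = poisson e y.
Proof.
move=> e0.
have H z : \int[mu]_x abel e x + \int[mu]_x (abel e x * cos (z * x)) = 2 / e + poisson e z.
  rewrite -RintegralD//; [|exact: integrable_abel|exact: integrable_abel_cos].
  rewrite /Rintegral; under eq_integral do rewrite -[X in X + _]mulr1 -mulrDr.
  by rewrite integral_abel_1Dcos.
(* At z = 0 the identity [H] says that twice the mass of the weight is 4 / e; subtracting the mass
   from [H y] leaves the cosine integral. *)
have H0 : \int[mu]_x abel e x = 2 / e.
  have := H 0; under [X in _ + X = _]eq_Rintegral do rewrite mul0r cos0 mulr1.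
  have -> : poisson e 0 = 2 / e.
    by rewrite /poisson expr0n addr0; field; rewrite gt_eqF.
  lra.
by have := H y; rewrite H0 => /addrI.
Qed.

Lemma Rintegral_abel_sin e y : 0 < e -> \int[mu]_x (abel e x * sin (y * x)) = 0.
Proof.
move=> e0.
have ms : measurable_fun setT (fun x => sin (y * x)).
  by apply: continuous_measurable_fun; apply: continuous_scale; exact: continuous_sin.
have ias : mu.-integrable setT (EFin \o (fun x => abel e x * sin (y * x))).
  apply: (integrableM_bounded (M := 1)) => //; first exact: integrable_abel.
  by move=> x; exact: sin_norm_le1.
have := Rintegral_opp (integrable_measurable ias).
under eq_Rintegral do rewrite /abel normrN mulrN sinN mulrN -mulN1r.
rewrite RintegralZl//.
rewrite -/(abel e _) => ?; lra.
Qed.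

Lemma integral_poisson_itv e t c d : 0 < e -> c < d ->
  (\int[mu]_(x in `[c, d]) (poisson e (t + x))%:E =
   (2 * (atan (e^-1 * (t + d)) - atan (e^-1 * (t + c))))%:E)%E.
Proof.
move=> e0 cd; rewrite mulrBr.
apply: (@FTC_segment (fun x => 2 * atan (e^-1 * (t + x))) (fun x => poisson e (t + x))) => //.
- move=> x; apply: continuous_comp; last exact: continuous_poisson.
  by apply: cvgD; [exact: cvg_cst|exact: cvg_id].
- by move=> x; exact: is_derive_atan_scale.
Qed.

Lemma measurable_poisson e t : 0 < e -> measurable_fun setT (fun x => poisson e (t + x)).
Proof.
move=> e0; apply: continuous_measurable_fun => x.
apply: continuous_comp; last exact: continuous_poisson.
by apply: cvgD; [exact: cvg_cst|exact: cvg_id].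
Qed.

Lemma integral_poisson_le e t : 0 < e ->
  (\int[mu]_x (poisson e (t + x))%:E <= (2 * pi)%:E)%E.
Proof.
move=> e0.
(* The successor keeps every interval nondegenerate, as [integral_poisson_itv] requires. A
   difference of two arctangents stays below pi, which bounds all these integrals by 2 pi. *)
pose I (n : nat) : set R := `[- n.+1%:R, n.+1%:R]%classic.
have T : [set: R] = \bigcup_n I n.
  apply/seteqP; split=> // x _; exists (Num.truncn `|x|) => //=.
  by rewrite /I/= in_itv/= -ler_norml ltW// truncnS_gt.
rewrite T.
have H : (\int[mu]_(x in I n) (poisson e (t + x))%:E)%E @[n --> \oo] -->
   (\int[mu]_(x in \bigcup_n I n) (poisson e (t + x))%:E)%E.
  apply: ge0_nondecreasing_set_cvg_integral => //.
  - move=> m n mn; apply/subsetPset => x /=; rewrite /I/= !in_itv/= -!ler_norml.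
    by move=> /le_trans; apply; rewrite ler_nat.
  - by move=> n; exact: measurable_itv.
  - by move=> n; apply/measurable_EFinP/measurable_funTS; exact: measurable_poisson.
  - by move=> n x _; rewrite lee_fin poisson_ge0.
rewrite -(cvg_lim _ H)//; apply: lime_le; first by apply/cvg_ex; eexists; exact: H.
apply: nearW => n; rewrite integral_poisson_itv//; last by rewrite gtrN.
rewrite lee_fin ler_pM2l//.
have := atan_ltpi2 (e^-1 * (t + n.+1%:R)); have := atan_gtNpi2 (e^-1 * (t - n.+1%:R)).
lra.
Qed.

End Poisson.

(** * Plancherel inequality *)

Section Plancherel.
Context {R : realType}.
Local Notation mu := (@lebesgue_measure R).
Implicit Types (e x y t : R) (a : R -> R).

(** With [phi] the cosine or the sine; four such real integrals make up [fourier1] of a complex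
    function. *)
Definition osc (phi a : R -> R) (w : R) : R := \int[mu]_t (a t * phi (w * t)).
Local Notation cosT := (osc cos).
Local Notation sinT := (osc sin).

Lemma measurable_scale (phi : R -> R) y : continuous phi ->
  measurable_fun setT (fun x => phi (y * x)).
Proof.
by move=> cphi; apply: continuous_measurable_fun; exact: continuous_scale.
Qed.

Lemma measurable_prod_scale (phi : R -> R) : continuous phi ->
  measurable_fun setT (fun z : R * R => phi (z.1 * z.2)).
Proof.
move=> cphi; apply: (measurableT_comp (continuous_measurable_fun cphi)).
by apply: measurable_funM; [exact: measurable_fst|exact: measurable_snd].
Qed.

(** The majorant M |a| does not depend on the parameter, so any neighbourhood of x serves.
    Continuity is the route to measurability of the transforms and of the Poisson integrals. *)
Lemma continuous_Rintegral_kernel (k : R -> R -> R) M a :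
  mu.-integrable setT (EFin \o a) -> (forall w, measurable_fun setT (k w)) ->
  (forall w t, `|k w t| <= M) -> (forall t, continuous (k ^~ t)) ->
  continuous (fun w => \int[mu]_t (a t * k w t)).
Proof.
move=> ia mk kM ck x.
apply: (@continuity_under_integral R _ _ mu (fun w t => a t * k w t) setT
  measurableT (x - 1) (x + 1) _ _ (fun t => M * `|a t|) _ _ x).
- by move=> w _; apply: (integrableM_bounded (M := M)).
- by apply: aeW => t _ w _; apply: cvgMl_tmp; exact: ck.
- have -> : EFin \o (fun x => M * `|a x|) = (fun x => M%:E * (`|a x|)%:E)%E.
    by apply/funext => t /=; rewrite EFinM.
  by apply: integrableZl => //; exact: integrable_norm.
- by move=> w _; apply: aeW => t _; rewrite normrM mulrC ler_wpM2r.
- by rewrite inE/= in_itv/= ltrBlDr ltrDl ltr01.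
Qed.

Section osc.
Variable phi : R -> R.
Hypothesis cphi : continuous phi.
Hypothesis phi1 : forall x, `|phi x| <= 1.

Lemma integrable_osc a w : mu.-integrable setT (EFin \o a) ->
  mu.-integrable setT (EFin \o (fun t => a t * phi (w * t))).
Proof.
by move=> ia; apply: (integrableM_bounded (M := 1)) => //; exact: measurable_scale.
Qed.

Lemma osc_bound a w : mu.-integrable setT (EFin \o a) ->
  `|osc phi a w| <= \int[mu]_t `|a t|.
Proof.
move=> ia; rewrite -[leRHS]mul1r; apply: Rintegral_bounded => //.
exact: measurable_scale.
Qed.

Lemma continuous_osc a : mu.-integrable setT (EFin \o a) -> continuous (osc phi a).
Proof.
move=> ia; apply: (continuous_Rintegral_kernel (M := 1)) => // [w|t w].
- exact: measurable_scale.
- have -> : (fun x => phi (x * t)) = (fun x => phi (t * x)).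
    by apply/funext => z; rewrite mulrC.
  exact: continuous_scale.
Qed.

Lemma measurable_osc a : mu.-integrable setT (EFin \o a) ->
  measurable_fun setT (osc phi a).
Proof.
by move=> ia; apply: continuous_measurable_fun; exact: continuous_osc.
Qed.

Lemma oscD a b w : mu.-integrable setT (EFin \o a) -> mu.-integrable setT (EFin \o b) ->
  osc phi (fun t => a t + b t) w = osc phi a w + osc phi b w.
Proof.
move=> ia ib; rewrite /osc -RintegralD//; last 2 first.
- exact: integrable_osc.
- exact: integrable_osc.
by apply: eq_Rintegral => t _; rewrite mulrDl.
Qed.

Lemma oscZ c a w : mu.-integrable setT (EFin \o a) ->
  osc phi (fun t => c * a t) w = c * osc phi a w.
Proof.
move=> ia; rewrite /osc -RintegralZl//; last exact: integrable_osc.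
by apply: eq_Rintegral => t _; rewrite mulrA.
Qed.

End osc.

(** Read from right to left, this merges the phases of two successive transforms into one kernel,
    ready for the exchange of integrals. *)
Lemma osc_cosD a x w : mu.-integrable setT (EFin \o a) ->
  \int[mu]_t (a t * cos (w * (t + x))) =
  cosT a w * cos (w * x) - sinT a w * sin (w * x).
Proof.
move=> ia.
have ic := integrable_osc (@continuous_cos R) (@cos_norm_le1 R) w ia.
have iS := integrable_osc (@continuous_sin R) (@sin_norm_le1 R) w ia.
rewrite /osc -!RintegralZr// -RintegralB//; last 2 first.
- by apply: (integrableM_bounded (b := cst _) (M := 1)) => //= _; exact: cos_norm_le1.
- by apply: (integrableM_bounded (b := cst _) (M := 1)) => //= _; exact: sin_norm_le1.
by apply: eq_Rintegral => t _; rewrite mulrDr cosD; ring.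
Qed.

Lemma osc_sinD a x w : mu.-integrable setT (EFin \o a) ->
  \int[mu]_t (a t * sin (w * (t + x))) =
  sinT a w * cos (w * x) + cosT a w * sin (w * x).
Proof.
move=> ia.
have ic := integrable_osc (@continuous_cos R) (@cos_norm_le1 R) w ia.
have iS := integrable_osc (@continuous_sin R) (@sin_norm_le1 R) w ia.
rewrite /osc -!RintegralZr// -RintegralD//; last 2 first.
- by apply: (integrableM_bounded (b := cst _) (M := 1)) => //= _; exact: cos_norm_le1.
- by apply: (integrableM_bounded (b := cst _) (M := 1)) => //= _; exact: sin_norm_le1.
by apply: eq_Rintegral => t _; rewrite mulrDr sinD; ring.
Qed.

Lemma measurable_prod_scaleD (phi : R -> R) x : continuous phi ->
  measurable_fun setT (fun z : R * R => phi (z.1 * (z.2 + x))).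
Proof.
move=> cphi; apply: (measurableT_comp (continuous_measurable_fun cphi)).
apply: measurable_funM; first exact: measurable_fst.
by apply: measurable_funD => //; exact: measurable_snd.
Qed.

(** The sign in t + x is that of a second forward transform, not of an inverse one; it is the origin
    of the reflection in the inversion formula. *)
Lemma abel_cos_poisson e a x : 0 < e -> mu.-integrable setT (EFin \o a) ->
  \int[mu]_w (abel e w * (cosT a w * cos (w * x) - sinT a w * sin (w * x))) =
  \int[mu]_t (a t * poisson e (t + x)).
Proof.
move=> e0 ia.
under eq_Rintegral do rewrite -osc_cosD//.
rewrite (Rintegral_exchange (k := fun w t => cos (w * (t + x))) (M := 1))//.
- apply: eq_Rintegral => t _; congr (_ * _).
  by under eq_Rintegral do rewrite [_ * (t + x)]mulrC; exact: Rintegral_abel_cos.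
- exact: integrable_abel.
- by apply: measurable_prod_scaleD; exact: continuous_cos.
- by move=> *; exact: cos_norm_le1.
Qed.

(** The weight is even and the sine odd. These integrals are the cross terms of a double transform,
    and they drop out. *)
Lemma abel_sin_poisson e a x : 0 < e -> mu.-integrable setT (EFin \o a) ->
  \int[mu]_w (abel e w * (sinT a w * cos (w * x) + cosT a w * sin (w * x))) = 0.
Proof.
move=> e0 ia.
under eq_Rintegral do rewrite -osc_sinD//.
rewrite (Rintegral_exchange (k := fun w t => sin (w * (t + x))) (M := 1))//.
- under eq_Rintegral => t _.
    rewrite (_ : \int[mu]_w _ = 0); last first.
      by under eq_Rintegral do rewrite [_ * (t + x)]mulrC; exact: Rintegral_abel_sin.
    rewrite mulr0; over.
  by rewrite Rintegral_cst// mul0r.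
- exact: integrable_abel.
- by apply: measurable_prod_scaleD; exact: continuous_sin.
- by move=> *; exact: sin_norm_le1.
Qed.

(** One factor of each square is opened as an integral over s, while the other, bounded by the L^1
    norm of [a], stays inside the kernel [k]. After the exchange the inner integral is
    [abel_cos_poisson] at -s. *)
Lemma abel_energy e a : 0 < e -> mu.-integrable setT (EFin \o a) ->
  \int[mu]_w (abel e w * (cosT a w ^+ 2 + sinT a w ^+ 2)) =
  \int[mu]_s (a s * \int[mu]_t (a t * poisson e (t - s))).
Proof.
move=> e0 ia.
have ic w := integrable_osc (@continuous_cos R) (@cos_norm_le1 R) w ia.
have iS w := integrable_osc (@continuous_sin R) (@sin_norm_le1 R) w ia.
pose k w s := cosT a w * cos (w * s) + sinT a w * sin (w * s).
have E w : cosT a w ^+ 2 + sinT a w ^+ 2 = \int[mu]_s (a s * k w s).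
  rewrite !expr2 {1}/osc {2}/osc -!RintegralZr// -RintegralD//; last 2 first.
  - apply: (integrableM_bounded (b := cst _) (M := \int[mu]_t `|a t|)) => //= _.
    by apply: osc_bound => //; [exact: continuous_cos|exact: cos_norm_le1].
  - apply: (integrableM_bounded (b := cst _) (M := \int[mu]_t `|a t|)) => //= _.
    by apply: osc_bound => //; [exact: continuous_sin|exact: sin_norm_le1].
  by apply: eq_Rintegral => t _; rewrite /k; ring.
under eq_Rintegral do rewrite E.
rewrite (Rintegral_exchange (k := k) (M := 2 * \int[mu]_t `|a t|) (integrable_abel e0) ia).
- apply: eq_Rintegral => s _; congr (_ * _).
  rewrite -abel_cos_poisson//; apply: eq_Rintegral => w _; congr (_ * _).
  by rewrite /k mulrN cosN sinN mulrN opprK.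
- apply: measurable_funD; apply: measurable_funM.
  + apply: measurableT_comp measurable_fst.
    by apply: measurable_osc => //; [exact: continuous_cos|exact: cos_norm_le1].
  + by apply: measurable_prod_scale; exact: continuous_cos.
  + apply: measurableT_comp measurable_fst.
    by apply: measurable_osc => //; [exact: continuous_sin|exact: sin_norm_le1].
  + by apply: measurable_prod_scale; exact: continuous_sin.
- move=> w s; rewrite /k mulr_natl mulr2n.
  apply: le_trans (ler_normD _ _) _; rewrite !normrM; apply: lerD.
  + apply: le_trans (_ : `|cosT a w| * 1 <= _); first by rewrite ler_wpM2l// cos_norm_le1.
    by rewrite mulr1; apply: osc_bound => //; [exact: continuous_cos|exact: cos_norm_le1].
  + apply: le_trans (_ : `|sinT a w| * 1 <= _); first by rewrite ler_wpM2l// sin_norm_le1.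
    by rewrite mulr1; apply: osc_bound => //; [exact: continuous_sin|exact: sin_norm_le1].
Qed.

Lemma continuous_poisson_integral e a : 0 < e -> mu.-integrable setT (EFin \o a) ->
  continuous (fun x => \int[mu]_t (a t * poisson e (t + x))).
Proof.
move=> e0 ia; apply: (continuous_Rintegral_kernel (M := 2 / e)) => //.
- by move=> x; under eq_fun do rewrite addrC; exact: measurable_poisson.
- by move=> x t; exact: poisson_le.
- move=> t x; apply: continuous_comp; last exact: continuous_poisson.
  by apply: cvgD; [exact: cvg_cst|exact: cvg_id].
Qed.

(* Schur test: |a(s) a(t)| <= (a(s)^2 + a(t)^2) / 2, and the kernel has mass at
   most 2 pi in each variable. *)
Lemma poisson_form_bound e a : 0 < e -> mu.-integrable setT (EFin \o a) ->
  ((\int[mu]_s (a s * \int[mu]_t (a t * poisson e (t - s))))%:E <=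
   (2 * pi)%:E * \int[mu]_t (a t ^+ 2)%:E)%E.
Proof.
move=> e0 ia; have ma := integrable_measurable ia.
have mK : measurable_fun setT (fun z : R * R => poisson e (z.2 - z.1)).
  apply: (measurableT_comp (continuous_measurable_fun (continuous_poisson e0))).
  by apply: measurable_funB; [exact: measurable_snd|exact: measurable_fst].
have mK1 s : measurable_fun setT (fun t => poisson e (t - s)).
  by under eq_fun do rewrite addrC; exact: measurable_poisson.
have ma2 : measurable_fun setT (fun t => a t ^+ 2) by exact: measurable_funX.
(* [H] and [H'] carry the two squares of the Schur bound, a(s)^2 and a(t)^2 respectively. *)
pose H (z : R * R) : \bar R := (a z.1 ^+ 2 * poisson e (z.2 - z.1))%:E.
have mH : measurable_fun setT H.
  by apply/measurable_EFinP/measurable_funM => //; exact: (measurableT_comp ma2 measurable_fst).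
have H0 z : (0 <= H z)%E by rewrite lee_fin mulr_ge0 ?sqr_ge0 ?poisson_ge0.
pose H' (z : R * R) : \bar R := (a z.2 ^+ 2 * poisson e (z.1 - z.2))%:E.
have mH' : measurable_fun setT H'.
  apply/measurable_EFinP/measurable_funM; first exact: (measurableT_comp ma2 measurable_snd).
  apply: (measurableT_comp (continuous_measurable_fun (continuous_poisson e0))).
  by apply: measurable_funB; [exact: measurable_fst|exact: measurable_snd].
have H'0 z : (0 <= H' z)%E by rewrite lee_fin mulr_ge0 ?sqr_ge0 ?poisson_ge0.
pose Q := (\int[mu]_t (a t ^+ 2)%:E)%E.
have HQ : (\int[mu]_s \int[mu]_t H (s, t) <= (2 * pi)%:E * Q)%E.
  rewrite /Q -ge0_integralZl//; last 3 first.
  - exact/measurable_EFinP.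
  - by move=> t _; rewrite lee_fin sqr_ge0.
  - by rewrite lee_fin mulr_ge0 ?pi_ge0.
  apply: ge0_le_integral => //.
  - by move=> s _; exact: integral_ge0.
  - exact: (@measurable_fun_fubini_tonelli_F _ _ _ _ R mu H).
  - by apply: emeasurable_funM => //; exact/measurable_EFinP.
  - move=> s _; rewrite /H/=.
    under eq_integral do rewrite EFinM.
    rewrite ge0_integralZl//; last 3 first.
    + by apply/measurable_EFinP; exact: mK1.
    + by move=> t _; rewrite lee_fin poisson_ge0.
    + by rewrite lee_fin sqr_ge0.
    rewrite muleC lee_wpmul2r ?lee_fin ?sqr_ge0//.
    by under eq_integral do rewrite addrC; exact: integral_poisson_le.
(* Swapping the order of integration and renaming the variables turns [H'] into [H]. *)
have H'Q : (\int[mu]_s \int[mu]_t H' (s, t) <= (2 * pi)%:E * Q)%E.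
  have -> // : (\int[mu]_s \int[mu]_t H' (s, t) = \int[mu]_s \int[mu]_t H (s, t))%E.
  exact: (@fubini_tonelli _ _ _ _ R mu mu H' mH' H'0).
pose U s := \int[mu]_t (a t * poisson e (t - s)).
have iaK s : mu.-integrable setT (EFin \o (fun t => a t * poisson e (t - s))).
  apply: (integrableM_bounded (M := 2 / e)) => // t; exact: poisson_le.
have maK s : measurable_fun setT (fun t => (a t * poisson e (t - s))%:E).
  by apply/measurable_EFinP; exact: integrable_measurable (iaK s).
have mHs s : measurable_fun setT (fun t => H (s, t)).
  exact: (measurable_fun_pair2 (f := H)).
have mHs' s : measurable_fun setT (fun t => H' (s, t)).
  exact: (measurable_fun_pair2 (f := H')).
have mU : measurable_fun setT U.
  have -> : U = (fun x => \int[mu]_t (a t * poisson e (t + x))) \o -%R by [].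
  apply: measurableT_comp; last exact: oppr_measurable.
  by apply: continuous_measurable_fun; exact: continuous_poisson_integral.
have iaU : mu.-integrable setT (EFin \o (fun s => a s * U s)).
  apply: (integrableM_bounded (M := 2 / e * \int[mu]_t `|a t|)) => // s.
  by apply: Rintegral_bounded => // t; exact: poisson_le.
have aU s : (`|a s * U s|%:E <= \int[mu]_t ((2^-1)%:E * (H (s, t) + H' (s, t))))%E.
  rewrite normrM EFinM.
  rewrite /U (EFin_normr_Rintegral measurableT (iaK s)).
  apply: (@le_trans _ _ (`|a s|%:E * \int[mu]_t `|(a t * poisson e (t - s))%:E|)%E).
    by rewrite lee_wpmul2l//; apply: le_abse_integral => //; exact: maK.
  rewrite -ge0_integralZl//; last by apply: measurableT_comp => //; exact: maK.
  apply: ge0_le_integral => //.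
  - by apply: emeasurable_funM => //; apply: measurableT_comp => //; exact: maK.
  - by apply: emeasurable_funM => //; apply: emeasurable_funD; [exact: mHs|exact: mHs'].
  - move=> t _; rewrite /H/H'/= -[s - t]opprB poissonN -EFinD -!EFinM lee_fin.
    have := poisson_ge0 (t - s) e0; move: (poisson e (t - s)) => K K0.
    rewrite -mulrDl normrM (ger0_norm K0) !mulrA ler_wpM2r//.
    rewrite -(real_normK (num_real (a s))) -(real_normK (num_real (a t))).
    by have := sqr_ge0 (`|a s| - `|a t|); lra.
apply: (@le_trans _ _ (\int[mu]_s \int[mu]_t ((2^-1)%:E * (H (s, t) + H' (s, t))))%E).
  apply: (@le_trans _ _ (\int[mu]_s `|a s * U s|%:E)%E).
    apply: (@le_trans _ _ (`|\int[mu]_s (a s * U s)|%:E)); first by rewrite lee_fin ler_norm.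
    rewrite EFin_normr_Rintegral//; apply: le_abse_integral => //.
    by apply/measurable_EFinP; exact: integrable_measurable.
  apply: ge0_le_integral => //.
  - by apply/measurable_EFinP; apply: measurableT_comp => //; exact: integrable_measurable.
  - apply: (@measurable_fun_fubini_tonelli_F _ _ _ _ R mu (fun z => (2^-1)%:E * (H z + H' z))%E).
    + by apply: emeasurable_funM => //; exact: emeasurable_funD.
    + by move=> z; rewrite mule_ge0// adde_ge0.
rewrite -(@fubini_tonelli1 _ _ _ _ R mu mu (fun z => (2^-1)%:E * (H z + H' z))%E); last 2 first.
- by apply: emeasurable_funM => //; exact: emeasurable_funD.
- by move=> z; rewrite mule_ge0// adde_ge0.
rewrite ge0_integralZl//; last 2 first.
- exact: emeasurable_funD.
- by move=> z _; rewrite adde_ge0.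
rewrite ge0_integralD// (@fubini_tonelli1 _ _ _ _ R mu mu H)//.
rewrite (@fubini_tonelli1 _ _ _ _ R mu mu H')//.
apply: (@le_trans _ _ ((2^-1)%:E * ((2 * pi)%:E * Q + (2 * pi)%:E * Q))%E).
  by rewrite lee_wpmul2l// leeD.
rewrite -/Q.
have : (0 <= (2 * pi)%:E * Q)%E.
  by rewrite mule_ge0 ?integral_ge0// ?lee_fin ?mulr_ge0 ?pi_ge0// => t _; rewrite lee_fin sqr_ge0.
(* The function [a] is only known to be in L^1, so the bound may be infinite. *)
case: ((2 * pi)%:E * Q)%E => [r| |]// _; last by rewrite leey.
by rewrite -EFinD -EFinM lee_fin; lra.
Qed.

Lemma cvg_abel x : abel n.+1%:R^-1 x @[n --> \oo] --> (1 : R).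
Proof.
rewrite /abel -[X in _ --> X]expR0; apply: continuous_cvg; first exact: continuous_expR.
rewrite -[X in _ --> X]oppr0; apply: cvgN.
by rewrite -[X in _ --> X](mul0r `|x|); apply: cvgMr_tmp; exact: cvg_harmonic.
Qed.

Lemma plancherel_ineq a : mu.-integrable setT (EFin \o a) ->
  (\int[mu]_w (cosT a w ^+ 2 + sinT a w ^+ 2)%:E <=
   (2 * pi)%:E * \int[mu]_t (a t ^+ 2)%:E)%E.
Proof.
move=> ia.
have mc : measurable_fun setT (cosT a).
  by apply: measurable_osc => //; [exact: continuous_cos|exact: cos_norm_le1].
have ms : measurable_fun setT (sinT a).
  by apply: measurable_osc => //; [exact: continuous_sin|exact: sin_norm_le1].
pose E w := cosT a w ^+ 2 + sinT a w ^+ 2.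
have mE : measurable_fun setT E by apply: measurable_funD; exact: measurable_funX.
have E0 w : 0 <= E w by rewrite addr_ge0 ?sqr_ge0.
pose M := \int[mu]_t `|a t|.
(* Boundedness of [E] makes each weighted energy finite, so that [abel_energy], an identity between
   real numbers, applies to it. *)
have EM w : `|E w| <= 2 * M ^+ 2.
  have c1 : `|cosT a w| <= M by apply: osc_bound => //; [exact: continuous_cos|exact: cos_norm_le1].
  have s1 : `|sinT a w| <= M by apply: osc_bound => //; [exact: continuous_sin|exact: sin_norm_le1].
  rewrite ger0_norm// /E -(real_normK (num_real (cosT a w))) -(real_normK (num_real (sinT a w))).
  have M0 : 0 <= M by apply: le_trans c1.
  have : `|cosT a w| ^+ 2 <= M ^+ 2 by rewrite ler_sqr ?nnegrE.
  have : `|sinT a w| ^+ 2 <= M ^+ 2 by rewrite ler_sqr ?nnegrE.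
  lra.
pose g (n : nat) w : \bar R := (abel n.+1%:R^-1 w * E w)%:E.
(* The weights increase to 1 with n, so monotone convergence applies although [E] is not yet known
   to be integrable. *)
have H : (\int[mu]_w g n w)%E @[n --> \oo] --> (\int[mu]_w limn (g ^~ w))%E.
  apply: cvg_monotone_convergence => //.
  - by move=> n; apply/measurable_EFinP/measurable_funM => //; exact: measurable_abel.
  - by move=> n w _; rewrite lee_fin mulr_ge0// ltW// abel_gt0.
  - move=> w _ m n mn; rewrite lee_fin ler_wpM2r// ler_expR lerN2 ler_wpM2r//.
    by rewrite lef_pV2 ?posrE// ler_nat.
have L w : limn (g ^~ w) = (E w)%:E.
  apply/cvg_lim => //; apply: cvg_EFin; first exact: nearW.
  rewrite /=.
  rewrite -[X in _ --> X]mul1r; apply: cvgMr_tmp.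
  exact: cvg_abel.
under eq_integral => w _ do rewrite -/(E w) -L.
rewrite -(cvg_lim _ H)//; apply: lime_le; first by apply/cvg_ex; eexists; exact: H.
apply: nearW => n.
have n0 : 0 < n.+1%:R^-1 :> R by rewrite invr_gt0.
have iE : mu.-integrable setT (EFin \o (fun w => abel n.+1%:R^-1 w * E w)).
  by apply: (integrableM_bounded (M := 2 * M ^+ 2)) => //; exact: integrable_abel.
rewrite -[leLHS]fineK; last by apply: integrable_fin_num.
rewrite [X in (X%:E <= _)%E](_ : _ = \int[mu]_w (abel n.+1%:R^-1 w * E w))//.
by rewrite abel_energy//; exact: poisson_form_bound.
Qed.

End Plancherel.

(** * Energy of complex-valued functions *)

Local Open Scope complex_scope.

Section Energy.
Context {R : realType}.
Local Notation mu := (@lebesgue_measure R).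
Implicit Types (f g : R -> R[i]) (z w : R[i]).

Definition sqmod z : R := complex.Re z ^+ 2 + complex.Im z ^+ 2.
(** The squared L^2 norm, with values in the extended reals. Working without the square root makes
    it split over real and imaginary parts; the price is a factor 2 in place of the triangle
    inequality, harmless for limits. *)
Definition energy f : \bar R := (\int[mu]_t (sqmod (f t))%:E)%E.
Definition cmeasurable f :=
  measurable_fun setT (fun t => complex.Re (f t)) /\
  measurable_fun setT (fun t => complex.Im (f t)).
Definition cintegrable f :=
  mu.-integrable setT (EFin \o (fun t => complex.Re (f t))) /\
  mu.-integrable setT (EFin \o (fun t => complex.Im (f t))).

Lemma sqmod_ge0 z : 0 <= sqmod z. Proof. by rewrite addr_ge0 ?sqr_ge0. Qed.
Hint Resolve sqmod_ge0 : core.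

Lemma ReD z w : complex.Re (z + w) = complex.Re z + complex.Re w.
Proof. by case: z w => [? ?] [? ?]. Qed.
Lemma ImD z w : complex.Im (z + w) = complex.Im z + complex.Im w.
Proof. by case: z w => [? ?] [? ?]. Qed.
Lemma ReB z w : complex.Re (z - w) = complex.Re z - complex.Re w.
Proof. by case: z w => [? ?] [? ?]. Qed.
Lemma ImB z w : complex.Im (z - w) = complex.Im z - complex.Im w.
Proof. by case: z w => [? ?] [? ?]. Qed.
Lemma ReM z w : complex.Re (z * w) =
  complex.Re z * complex.Re w - complex.Im z * complex.Im w.
Proof. by case: z w => [? ?] [? ?]. Qed.
Lemma ImM z w : complex.Im (z * w) =
  complex.Re z * complex.Im w + complex.Im z * complex.Re w.
Proof. by case: z w => [? ?] [? ?]. Qed.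
Lemma complexP z w : complex.Re z = complex.Re w -> complex.Im z = complex.Im w -> z = w.
Proof. by case: z w => [? ?] [? ?] /= -> ->. Qed.

(** The parallelogram law with the term |z - w|^2 dropped. *)
Lemma sqmodD z w : sqmod (z + w) <= 2 * sqmod z + 2 * sqmod w.
Proof.
rewrite /sqmod ReD ImD.
have := sqr_ge0 (complex.Re z - complex.Re w).
have := sqr_ge0 (complex.Im z - complex.Im w).
lra.
Qed.

Lemma sqmodM z w : sqmod (z * w) = sqmod z * sqmod w.
Proof. by rewrite /sqmod ReM ImM; ring. Qed.

Lemma sqmod_eq0 z : sqmod z = 0 -> z = 0.
Proof.
case: z => x y; rewrite /sqmod/= => /eqP.
by rewrite paddr_eq0 ?sqr_ge0// !sqrf_eq0 => /andP[/eqP -> /eqP ->].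
Qed.

Lemma normc_sqrt z : Normc.normc z = Num.sqrt (sqmod z).
Proof. by case: z. Qed.

Lemma cLnorm2E f : cLnorm 2%:E f = sqrte (energy f).
Proof.
rewrite /cLnorm unlock -poweR12_sqrt; last by apply: integral_ge0 => t _; rewrite lee_fin.
congr (_ `^ _)%E; apply: eq_integral => t _.
rewrite normc_sqrt /= ger0_norm ?sqrtr_ge0//.
by rewrite powR_mulrn ?sqrtr_ge0// sqr_sqrtr.
Qed.

Lemma energy_ge0 f : (0 <= energy f)%E.
Proof. by apply: integral_ge0 => t _; rewrite lee_fin. Qed.
Hint Resolve energy_ge0 : core.

Lemma cLfun2P f : cLfun 2%:E f <-> cmeasurable f /\ (energy f < +oo)%E.
Proof.
rewrite /cLfun cLnorm2E.
have -> : (sqrte (energy f) < +oo)%E = (energy f < +oo)%E.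
  by rewrite -!ge0_fin_numE ?sqrte_ge0// sqrte_fin_num.
by split=> [[]|[[]]].
Qed.

Lemma measurable_sqmod f : cmeasurable f ->
  measurable_fun setT (fun t => sqmod (f t)).
Proof. by case=> mr mi; apply: measurable_funD; exact: measurable_funX. Qed.

Lemma norm_le_normc z : `|complex.Re z| <= Normc.normc z /\
  `|complex.Im z| <= Normc.normc z /\
  Normc.normc z <= `|complex.Re z| + `|complex.Im z|.
Proof.
rewrite normc_sqrt; split; last split.
- by rewrite -sqrtr_sqr ler_sqrt// /sqmod lerDl sqr_ge0.
- by rewrite -sqrtr_sqr ler_sqrt// /sqmod lerDr sqr_ge0.
- rewrite -[leRHS]ger0_norm ?addr_ge0// -sqrtr_sqr ler_sqrt ?sqr_ge0// /sqmod.
  rewrite -(real_normK (num_real (complex.Re z))) -(real_normK (num_real (complex.Im z))).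
  by rewrite sqrrD lerD2r lerDl mulrn_wge0 ?mulr_ge0.
Qed.

Lemma measurable_normc f : cmeasurable f ->
  measurable_fun setT (fun t => Normc.normc (f t)).
Proof.
move=> mf; under eq_fun do rewrite normc_sqrt.
apply: (measurableT_comp _ (measurable_sqmod mf)).
by apply: continuous_measurable_fun; exact: sqrt_continuous.
Qed.

Lemma cLfun1P f : cLfun 1 f <-> cintegrable f.
Proof.
rewrite /cLfun /cLnorm Lnorm1; split.
- move=> [mr mi fi]; split; apply/integrableP; split; try exact/measurable_EFinP.
  + apply: le_lt_trans fi; apply: ge0_le_integral => //=.
    * by apply/measurable_EFinP/measurableT_comp.
    * by apply/measurable_EFinP/measurableT_comp => //; exact: measurable_normc.
    * move=> t _; rewrite lee_fin (le_trans (norm_le_normc (f t)).1)//.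
      by rewrite ler_norm.
  + apply: le_lt_trans fi; apply: ge0_le_integral => //=.
    * by apply/measurable_EFinP/measurableT_comp.
    * by apply/measurable_EFinP/measurableT_comp => //; exact: measurable_normc.
    * move=> t _; rewrite lee_fin (le_trans (norm_le_normc (f t)).2.1)//.
      by rewrite ler_norm.
- move=> [ir ii].
  have mr := integrable_measurable ir; have mi := integrable_measurable ii.
  split => //.
  have := integrableD measurableT (integrable_norm ir) (integrable_norm ii).
  move=> /integrableP[_]; apply: le_lt_trans.
  apply: ge0_le_integral => //=.
  + by apply/measurable_EFinP/measurableT_comp => //; exact: measurable_normc.
  + apply/measurable_EFinP; apply: measurableT_comp => //.
    by apply: measurable_funD; apply: measurableT_comp.
  + move=> t _; rewrite lee_fin.
    rewrite ger0_norm; last by rewrite normc_sqrt sqrtr_ge0.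
    by rewrite ger0_norm ?addr_ge0//; exact: (norm_le_normc (f t)).2.2.
Qed.

Lemma cmeasurableD f g : cmeasurable f -> cmeasurable g -> cmeasurable (f \+ g).
Proof.
move=> [fr fi] [gr gi]; split; rewrite /=.
- by under eq_fun do rewrite ReD; exact: measurable_funD.
- by under eq_fun do rewrite ImD; exact: measurable_funD.
Qed.

Lemma cmeasurableB f g : cmeasurable f -> cmeasurable g -> cmeasurable (f \- g).
Proof.
move=> [fr fi] [gr gi]; split; rewrite /=.
- by under eq_fun do rewrite ReB; exact: measurable_funB.
- by under eq_fun do rewrite ImB; exact: measurable_funB.
Qed.

Lemma cmeasurableZ z f : cmeasurable f -> cmeasurable (fun t => z * f t).
Proof.
move=> [fr fi]; split; rewrite /=.
- by under eq_fun do rewrite ReM; apply: measurable_funB; exact: measurable_funM.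
- by under eq_fun do rewrite ImM; apply: measurable_funD; exact: measurable_funM.
Qed.

Lemma cmeasurable_opp f : cmeasurable f -> cmeasurable (fun t => f (- t)).
Proof.
by move=> [fr fi]; split; [apply: (measurableT_comp fr)|apply: (measurableT_comp fi)];
  exact: oppr_measurable.
Qed.

Lemma cintegrable_measurable f : cintegrable f -> cmeasurable f.
Proof. by case=> *; split; exact: integrable_measurable. Qed.

Lemma energyD f g : cmeasurable f -> cmeasurable g ->
  (energy (f \+ g)%R <= 2%:E * energy f + 2%:E * energy g)%E.
Proof.
move=> mf mg; have mf2 := measurable_sqmod mf; have mg2 := measurable_sqmod mg.
rewrite /energy -!ge0_integralZl//; try by [exact/measurable_EFinP|move=> *; rewrite lee_fin].
rewrite -ge0_integralD//; first last.
- by apply/measurable_EFinP/measurable_funM.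
- by move=> t _; rewrite -EFinM lee_fin mulr_ge0.
- by apply/measurable_EFinP/measurable_funM.
- by move=> t _; rewrite -EFinM lee_fin mulr_ge0.
apply: ge0_le_integral => //.
- by move=> t _; rewrite lee_fin.
- by apply/measurable_EFinP; apply: measurable_sqmod; exact: cmeasurableD.
- by apply/measurable_EFinP; apply: measurable_funD; exact: measurable_funM.
- by move=> t _; rewrite lee_fin sqmodD.
Qed.

Lemma energyZ z f : cmeasurable f ->
  energy (fun t => z * f t) = ((sqmod z)%:E * energy f)%E.
Proof.
move=> mf; have mf2 := measurable_sqmod mf.
rewrite /energy -ge0_integralZl//.
- by apply: eq_integral => t _; rewrite sqmodM EFinM.
- exact/measurable_EFinP.
- by move=> t _; rewrite lee_fin.
- by rewrite lee_fin.
Qed.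

Lemma energy_opp f : cmeasurable f -> energy (fun t => f (- t)) = energy f.
Proof.
move=> mf; apply: (ge0_integral_opp (f := fun t => (sqmod (f t))%:E)).
- by apply/measurable_EFinP; exact: measurable_sqmod.
- by move=> t; rewrite lee_fin.
Qed.

Lemma energyE f : cmeasurable f -> energy f =
  (\int[mu]_t (complex.Re (f t) ^+ 2)%:E + \int[mu]_t (complex.Im (f t) ^+ 2)%:E)%E.
Proof.
move=> [mr mi]; rewrite /energy -ge0_integralD//.
- by move=> t _; rewrite lee_fin sqr_ge0.
- by apply/measurable_EFinP; exact: measurable_funX.
- by move=> t _; rewrite lee_fin sqr_ge0.
- by apply/measurable_EFinP; exact: measurable_funX.
Qed.

Lemma energy0_ae f g : cmeasurable f -> cmeasurable g ->
  energy (f \- g) = 0%E -> f = g %[ae mu].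
Proof.
move=> mf mg fg0.
have mfg := measurable_sqmod (cmeasurableB mf mg).
have mE : measurable_fun setT (fun t => (sqmod ((f \- g) t))%:E).
  by apply/measurable_EFinP; exact: mfg.
have [+ _] := ae_eq_integral_abs mu measurableT mE.
under eq_integral do rewrite gee0_abs ?lee_fin//.
move=> /(_ fg0); apply: (@filterS _ _ (ae_filter_ringOfSetsType mu)) => t /(_ I)/= [].
by move=> /sqmod_eq0/eqP; rewrite subr_eq0 => /eqP.
Qed.

Lemma ae_energy0 f g : cmeasurable f -> cmeasurable g ->
  f = g %[ae mu] -> energy (f \- g) = 0%E.
Proof.
move=> mf mg fg.
have mfg := measurable_sqmod (cmeasurableB mf mg).
rewrite /energy (@ge0_ae_eq_integral _ _ _ mu setT _ (cst 0%E))//.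
- by rewrite integral0.
- by apply/measurable_EFinP; exact: mfg.
- by move=> t _; rewrite lee_fin.
- move: fg; apply: (@filterS _ _ (ae_filter_ringOfSetsType mu)) => t /(_ I) fgt _.
  by rewrite /= fgt subrr /sqmod/= expr0n/= addr0.
Qed.

(** Lets energies replace norms in [is_fourier]. *)
Lemma cvg_cLnorm2P (u : nat -> R -> R[i]) :
  cLnorm 2%:E (u n) @[n --> \oo] --> 0%E <-> energy (u n) @[n --> \oo] --> 0%E.
Proof.
under eq_fun do rewrite cLnorm2E.
split.
- move=> h; have -> : (fun n => energy (u n)) =
      (fun n => sqrte (energy (u n)) * sqrte (energy (u n)))%E.
    by apply/funext => n; rewrite -{1}(sqr_sqrte (energy_ge0 (u n))) expe2.
  by rewrite -[X in _ --> X](mule0 0%E); apply: cvgeM.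
- move=> /fine_cvgP[nfin ncvg]; apply/fine_cvgP; split.
    by apply: filterS nfin => n; rewrite sqrte_fin_num.
  have : Num.sqrt (fine (energy (u n))) @[n --> \oo] --> (0 : R).
    rewrite -[X in _ --> X]sqrtr0; apply: continuous_cvg => //.
    exact: sqrt_continuous.
  apply: cvg_trans; apply: near_eq_cvg; apply: filterS nfin => n nf.
  by rewrite /= -{2}(fineK nf).
Qed.

End Energy.

(** * The Fourier integral on L^1 *)

Section Fourier1.
Context {R : realType}.
Local Notation mu := (@lebesgue_measure R).
Local Notation cosT := (osc (@cos R)).
Local Notation sinT := (osc (@sin R)).
Implicit Types (f g : R -> R[i]) (z : R[i]) (t w : R).

Lemma integrableD_real (a b : R -> R) :
  mu.-integrable setT (EFin \o a) -> mu.-integrable setT (EFin \o b) ->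
  mu.-integrable setT (EFin \o (fun t => a t + b t)).
Proof. by move=> ia ib; exact: (integrableD measurableT ia ib). Qed.

Lemma integrableZ_real c (a : R -> R) :
  mu.-integrable setT (EFin \o a) ->
  mu.-integrable setT (EFin \o (fun t => c * a t)).
Proof. by move=> ia; exact: (integrableZl measurableT c ia). Qed.

Lemma cintegrable_lin z f g : cintegrable f -> cintegrable g ->
  cintegrable (fun t => z * f t + g t).
Proof.
move=> [fr fi] [gr gi]; split.
- have -> : (fun t => complex.Re (z * f t + g t)) =
      (fun t => (complex.Re z * complex.Re (f t) + - complex.Im z * complex.Im (f t))
        + complex.Re (g t)).
    by apply/funext => t; rewrite ReD ReM mulNr.
  by apply: integrableD_real => //; apply: integrableD_real; exact: integrableZ_real.
- have -> : (fun t => complex.Im (z * f t + g t)) =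
      (fun t => (complex.Re z * complex.Im (f t) + complex.Im z * complex.Re (f t))
        + complex.Im (g t)).
    by apply/funext => t; rewrite ImD ImM.
  by apply: integrableD_real => //; apply: integrableD_real; exact: integrableZ_real.
Qed.

Lemma cintegrable_opp f : cintegrable f -> cintegrable (fun t => f (- t)).
Proof. by case=> *; split; apply: (integrable_opp (a := fun t => _ (f t))). Qed.

Lemma cexpE w t : cexp (- ('i * w%:C * t%:C)) = cos (w * t) +i* (- sin (w * t)).
Proof.
have -> : - ('i * w%:C * t%:C) = 0 +i* (- (w * t)) :> R[i].
  by apply: complexP; simpc => /=; ring.
by rewrite /cexp/= expR0 !mul1r cosN sinN.
Qed.

Lemma fourier1E f w : cintegrable f ->
  let a t := complex.Re (f t) in let b t := complex.Im (f t) in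
  fourier1 f w = (cosT a w + sinT b w) +i* (cosT b w - sinT a w).
Proof.
move=> [ia ib] a b.
have ica := integrable_osc (@continuous_cos R) (@cos_norm_le1 R) w ia.
have isa := integrable_osc (@continuous_sin R) (@sin_norm_le1 R) w ia.
have icb := integrable_osc (@continuous_cos R) (@cos_norm_le1 R) w ib.
have isb := integrable_osc (@continuous_sin R) (@sin_norm_le1 R) w ib.
rewrite /fourier1 /cintegral /osc -RintegralD// -RintegralB//.
apply: complexP => /=; apply: eq_Rintegral => t _; rewrite cexpE.
- by rewrite ReM/= /a /b; ring.
- by rewrite ImM/= /a /b; ring.
Qed.

Lemma cmeasurable_fourier1 f : cintegrable f -> cmeasurable (fourier1 f).
Proof.
move=> if_; have [ia ib] := if_.
have mca := measurable_osc (@continuous_cos R) (@cos_norm_le1 R) ia.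
have msa := measurable_osc (@continuous_sin R) (@sin_norm_le1 R) ia.
have mcb := measurable_osc (@continuous_cos R) (@cos_norm_le1 R) ib.
have msb := measurable_osc (@continuous_sin R) (@sin_norm_le1 R) ib.
split.
- by under eq_fun do rewrite fourier1E//=; exact: measurable_funD.
- by under eq_fun do rewrite fourier1E//=; exact: measurable_funB.
Qed.

Lemma fourier1_lin z f g : cintegrable f -> cintegrable g ->
  fourier1 (fun t => z * f t + g t) = (fun w => z * fourier1 f w + fourier1 g w).
Proof.
move=> if_ ig; apply/funext => w; rewrite !fourier1E//; last exact: cintegrable_lin.
move: if_ ig => [fr fi] [gr gi].
have lin phi : continuous phi -> (forall x, `|phi x| <= 1) ->
    osc phi (fun t => complex.Re (z * f t + g t)) w =
      complex.Re z * osc phi (fun t => complex.Re (f t)) w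
      - complex.Im z * osc phi (fun t => complex.Im (f t)) w
      + osc phi (fun t => complex.Re (g t)) w /\
    osc phi (fun t => complex.Im (z * f t + g t)) w =
      complex.Re z * osc phi (fun t => complex.Im (f t)) w
      + complex.Im z * osc phi (fun t => complex.Re (f t)) w
      + osc phi (fun t => complex.Im (g t)) w.
  move=> cphi phi1; split.
  - rewrite -mulNr -!oscZ// -!oscD//; try exact: integrableZ_real; last first.
      by apply: integrableD_real; exact: integrableZ_real.
    by congr (osc _ _ w); apply/funext => t; rewrite ReD ReM mulNr.
  - rewrite -!oscZ// -!oscD//; try exact: integrableZ_real; last first.
      by apply: integrableD_real; exact: integrableZ_real.
    by congr (osc _ _ w); apply/funext => t; rewrite ImD ImM.
have [-> ->] := lin _ (@continuous_cos R) (@cos_norm_le1 R).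
have [-> ->] := lin _ (@continuous_sin R) (@sin_norm_le1 R).
by apply: complexP; rewrite ?ReD ?ImD ?ReM ?ImM/=; ring.
Qed.

Lemma fourier1_opp f w : cintegrable f ->
  fourier1 (fun t => f (- t)) w = fourier1 f (- w).
Proof.
move=> if_; rewrite !fourier1E//; last exact: cintegrable_opp.
move: if_ => [fr fi].
have opp phi (a : R -> R) : continuous phi -> measurable_fun setT a ->
    osc phi (fun t => a (- t)) w = osc phi a (- w).
  move=> cphi ma; rewrite /osc -[RHS]Rintegral_opp.
    by apply: eq_Rintegral => t _; rewrite mulrNN.
  by apply: measurable_funM => //; exact: measurable_scale.
have mr := integrable_measurable fr; have mi := integrable_measurable fi.
by rewrite !(opp _ (fun t => complex.Re (f t)))// ?(opp _ (fun t => complex.Im (f t)))//;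
  try exact: continuous_cos; try exact: continuous_sin.
Qed.

(** The real and imaginary parts of f are treated separately by [plancherel_ineq]; bounding their
    cross terms by (x + y)^2 <= 2 x^2 + 2 y^2 doubles the sharp constant 2 pi. *)
Lemma energy_fourier1 f : cintegrable f ->
  (energy (fourier1 f) <= (4 * pi)%:E * energy f)%E.
Proof.
move=> if_; have [ia ib] := if_.
have mca := measurable_osc (@continuous_cos R) (@cos_norm_le1 R) ia.
have msa := measurable_osc (@continuous_sin R) (@sin_norm_le1 R) ia.
have mcb := measurable_osc (@continuous_cos R) (@cos_norm_le1 R) ib.
have msb := measurable_osc (@continuous_sin R) (@sin_norm_le1 R) ib.
have ha := plancherel_ineq ia; have hb := plancherel_ineq ib.
set a := (fun t => complex.Re (f t)) in ia mca msa ha.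
set b := (fun t => complex.Im (f t)) in ib mcb msb hb.
have mE (x y : R -> R) : measurable_fun setT x -> measurable_fun setT y ->
    measurable_fun setT (fun w => (x w ^+ 2 + y w ^+ 2)%:E).
  by move=> mx my; apply/measurable_EFinP; apply: measurable_funD; exact: measurable_funX.
have mA := mE _ _ mca msa; have mB := mE _ _ mcb msb.
apply: (@le_trans _ _ (2%:E * (\int[mu]_w (cosT a w ^+ 2 + sinT a w ^+ 2)%:E +
    \int[mu]_w (cosT b w ^+ 2 + sinT b w ^+ 2)%:E))%E).
  rewrite -ge0_integralD//; try by move=> w _; rewrite lee_fin addr_ge0 ?sqr_ge0.
  rewrite -ge0_integralZl//; first last.
  - by move=> w _; rewrite -EFinD lee_fin !addr_ge0 ?sqr_ge0.
  - exact: emeasurable_funD.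
  apply: ge0_le_integral => //.
  - by move=> w _; rewrite lee_fin sqmod_ge0.
  - by apply/measurable_EFinP; apply: measurable_sqmod; exact: cmeasurable_fourier1.
  - by apply: emeasurable_funM => //; exact: emeasurable_funD.
  - move=> w _; rewrite -EFinD -EFinM lee_fin fourier1E// /sqmod/= -/a -/b.
    have := sqr_ge0 (cosT a w - sinT b w); have := sqr_ge0 (cosT b w + sinT a w).
    lra.
rewrite energyE; last exact: cintegrable_measurable.
apply: (@le_trans _ _ (2%:E * ((2 * pi)%:E * \int[mu]_t (a t ^+ 2)%:E +
   (2 * pi)%:E * \int[mu]_t (b t ^+ 2)%:E))%E); first by rewrite lee_wpmul2l// leeD.
rewrite -ge0_muleDr; try by apply: integral_ge0 => t _; rewrite lee_fin sqr_ge0.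
by rewrite muleA -EFinM mulrA -natrM.
Qed.

End Fourier1.

(** * Completeness of L^2 *)

Section RieszFischer.
Context {R : realType}.

Lemma sqr_pow2 n : (2 ^+ n) ^+ 2 = 4 ^+ n :> R.
Proof. by rewrite -exprM mulnC exprM; congr (_ ^+ n); ring. Qed.

Local Notation mu := (@lebesgue_measure R).

Lemma geometric_increments_cvg (u : nat -> R) (g : R) :
  (forall n, `|u n.+1 - u n| <= g / 2 ^+ n) ->
  exists2 l : R, u n @[n --> \oo] --> l & forall n, `|l - u n| <= 2 * g / 2 ^+ n.
Proof.
move=> ug.
have g0 : 0 <= g by have := le_trans (normr_ge0 _) (ug 0%N); rewrite expr0 divr1.
(* The right side is the exact sum of the j geometric bounds from n on, so the induction step closes
   with an equality. *)
have tel n j : `|u (n + j)%N - u n| <= 2 * g / 2 ^+ n * (1 - (2 ^+ j)^-1).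
  elim: j => [|j ih]; first by rewrite addn0 subrr normr0 expr0 invr1 subrr mulr0.
  rewrite addnS -(subrK (u (n + j)%N) (u (n + j).+1)) -addrA.
  apply: le_trans (ler_normD _ _) _; apply: le_trans (lerD (ug _) ih) _.
  have p1 : 2 ^+ n != 0 :> R by rewrite expf_neq0.
  have p2 : 2 ^+ j != 0 :> R by rewrite expf_neq0.
  rewrite exprD exprS le_eqVlt; apply/orP; left; apply/eqP.
  by field; rewrite p1 p2.
have cu : cvgn u.
  have : cvgn (series (telescope u)).
    apply: normed_cvg; apply: (@series_le_cvg _ _ (geometric g 2^-1)).
    - by move=> n; exact: normr_ge0.
    - by move=> n; rewrite /geometric/= mulr_ge0.
    - by move=> n; rewrite /geometric/= /telescope exprVn; exact: ug.
    - by apply: is_cvg_geometric_series; rewrite ger0_norm// invf_lt1// ltr1n.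
  rewrite telescopeK => c.
  have -> : u = (fun n => (u n - u 0%N) + u 0%N) by apply/funext => n; rewrite subrK.
  by apply: is_cvgD => //; exact: is_cvg_cst.
exists (limn u); first exact: cu.
move=> n.
have cn : `|u (n + j)%N - u n| @[j --> \oo] --> `|limn u - u n|.
  apply: cvg_norm; apply: cvgB; last exact: cvg_cst.
  under eq_fun do rewrite addnC.
  have cu' : u k @[k --> \oo] --> limn u by exact: cu.
  by move: cu'; rewrite -(cvg_shiftn n).
rewrite -(cvg_lim _ cn)//; apply: limr_le; first by apply/cvg_ex; eexists; exact: cn.
apply: nearW => j; apply: le_trans (tel n j) _.
by rewrite ler_piMr ?divr_ge0 ?mulr_ge0// gerBl invr_ge0 exprn_ge0.
Qed.

(* With G = sum_k 4^k (a_(k+1) - a_k)^2, the increments satisfy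
   |a_(k+1) - a_k| <= sqrt G / 2^k, so the limit exists wherever G is finite and
   (A - a_n)^2 <= 4 G / 4^n there. *)
Lemma rapid_L2_limit (a : nat -> R -> R) (C : R) : 0 <= C ->
  (forall n, measurable_fun setT (a n)) ->
  (forall n, \int[mu]_t ((a n.+1 t - a n t) ^+ 2)%:E <= (C / 8 ^+ n)%:E)%E ->
  exists2 A : R -> R, measurable_fun setT A &
    forall n, (\int[mu]_t ((A t - a n t) ^+ 2)%:E <= (8 * C / 4 ^+ n)%:E)%E.
Proof.
move=> C0 ma aC.
pose d n t : \bar R := (4 ^+ n * (a n.+1 t - a n t) ^+ 2)%:E.
have d0 n t : (0 <= d n t)%E by rewrite lee_fin mulr_ge0 ?sqr_ge0 ?exprn_ge0.
have md1 n : measurable_fun setT (fun t => (a n.+1 t - a n t) ^+ 2).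
  by apply: measurable_funX; exact: measurable_funB.
have md n : measurable_fun setT (d n).
  by apply/measurable_EFinP; exact: measurable_funM.
pose G t : \bar R := (\sum_(k <oo) d k t)%E.
have mG : measurable_fun setT G.
  by apply: (@ge0_emeasurable_sum _ _ _ setT d xpredT) => //.
have G0 t : (0 <= G t)%E by apply: nneseries_ge0.
have dG n t : (d n t <= G t)%E.
  apply: le_trans (nneseries_lim_ge n.+1 _) => //.
  by rewrite big_nat_recr//= leeDr// sume_ge0.
have IG : (\int[mu]_t G t <= (2 * C)%:E)%E.
  rewrite /G integral_nneseries//.
  (* The factor 4^k against C / 8^k leaves C / 2^k, written as 2 C / 2^(k+1) to match the series of
     [epsilon_trick0]. *)
  apply: (@le_trans _ _ (\sum_(k <oo) ((2 * C) / (2 ^ k.+1)%:R)%:E)%E); last first.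
    by apply: epsilon_trick0; rewrite mulr_ge0.
  apply: lee_nneseries => [n _ _|n _]; first exact: integral_ge0.
  rewrite /d; under eq_integral do rewrite EFinM.
  rewrite ge0_integralZl//; last 2 first.
  - by apply/measurable_EFinP; exact: md1.
  - by move=> t _; rewrite lee_fin sqr_ge0.
  apply: le_trans (lee_wpmul2l _ (aC n)) _; first by rewrite lee_fin exprn_ge0.
  rewrite -EFinM lee_fin.
  have -> : 8 = 4 * 2 :> R by ring.
  have p4 : 4 ^+ n != 0 :> R by rewrite expf_neq0.
  have p2 : 2 ^+ n != 0 :> R by rewrite expf_neq0.
  rewrite natrX exprMn exprS le_eqVlt; apply/orP; left; apply/eqP.
  by field; rewrite p4 p2.
pose E := [set t | (G t < +oo)%E].
have mE : measurable E.
  have := @measurable_lte _ _ R setT measurableT G (cst +oo%E) mG (measurable_cst _).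
  by rewrite setTI.
have inc t n : E t -> `|a n.+1 t - a n t| <= Num.sqrt (fine (G t)) / 2 ^+ n.
  move=> Et; rewrite ler_pdivlMr ?exprn_gt0// -sqrtr_sqr.
  rewrite -(ger0_norm (x := 2 ^+ n)) ?exprn_ge0// -[X in _ * X]sqrtr_sqr -sqrtrM ?sqr_ge0//.
  rewrite ler_sqrt; last by rewrite fine_ge0.
  rewrite -lee_fin fineK ?ge0_fin_numE//; apply: le_trans (dG n t).
  by rewrite lee_fin mulrC sqr_pow2.
(* The value 0 off [E] makes [A] the pointwise limit, everywhere, of a_n times the indicator of [E];
   this gives its measurability. *)
have /choice[A HA] : forall t, exists l : R,
    (E t -> a n t @[n --> \oo] --> l /\
      forall n, `|l - a n t| <= 2 * Num.sqrt (fine (G t)) / 2 ^+ n) /\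
    (~ E t -> l = 0).
  move=> t; have [Et|Et] := pselect (E t).
    have [l ul lb] := geometric_increments_cvg (fun n => inc t n Et).
    by exists l; split=> // /(_ Et).
  by exists 0; split=> // /Et.
have mA : measurable_fun setT A.
  apply: (@measurable_fun_cvg _ _ R setT (fun n t => a n t * \1_E t)).
    by move=> n; apply: measurable_funM => //; exact: measurable_indic.
  move=> t _; have [Et|Et] := pselect (E t).
    rewrite indicE mem_set//=; under eq_fun do rewrite mulr1.
    by have [+ _] := HA t; move=> /(_ Et)[].
  rewrite indicE memNset//=; under eq_fun do rewrite mulr0.
  by have [_ /(_ Et) ->] := HA t; exact: cvg_cst.
exists A => // n.
have mAa : measurable_fun setT (fun t => (A t - a n t) ^+ 2).
  by apply: measurable_funX; exact: measurable_funB.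
have pw t : (((A t - a n t) ^+ 2)%:E <= (4 / 4 ^+ n)%:E * G t)%E.
  have [Et|Et] := pselect (E t); last first.
    have -> : G t = +oo%E by apply/eqP; rewrite -leye_eq leNgt; exact/negP.
    by rewrite gt0_muley ?leey// lte_fin divr_gt0// exprn_gt0.
  have [/(_ Et)[_ /(_ n) b] _] := HA t.
  rewrite -(fineK (x := G t)) ?ge0_fin_numE// -EFinM lee_fin.
  have s0 : 0 <= 2 * Num.sqrt (fine (G t)) / 2 ^+ n.
    by rewrite divr_ge0 ?mulr_ge0 ?sqrtr_ge0 ?exprn_ge0.
  rewrite -(real_normK (num_real _)).
  apply: le_trans (_ : (2 * Num.sqrt (fine (G t)) / 2 ^+ n) ^+ 2 <= _).
    by rewrite ler_sqr ?nnegrE.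
  rewrite expr_div_n exprMn sqr_sqrtr ?fine_ge0// sqr_pow2 mulrAC.
  by have -> : 2 ^+ 2 = 4 :> R by ring.
apply: (@le_trans _ _ (\int[mu]_t ((4 / 4 ^+ n)%:E * G t))%E).
  apply: ge0_le_integral => //.
  - by move=> t _; rewrite lee_fin sqr_ge0.
  - by apply/measurable_EFinP; exact: mAa.
  - by apply: emeasurable_funM.
rewrite ge0_integralZl//.
apply: le_trans (lee_wpmul2l _ IG) _; first by rewrite lee_fin divr_ge0 ?exprn_ge0.
by rewrite -EFinM lee_fin le_eqVlt; apply/orP; left; apply/eqP; ring.
Qed.

End RieszFischer.

(** * Fourier transform on L^2 *)

Section L2Fourier.
Context {R : realType}.
Local Notation mu := (@lebesgue_measure R).
Implicit Types (f g h F G : R -> R[i]) (z : R[i]).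

Definition cL2 f := cmeasurable f /\ (energy f < +oo)%E.
Definition cL12 f := cintegrable f /\ cL2 f.

Lemma cL12_meas f : cL12 f -> cmeasurable f. Proof. by case=> _ []. Qed.

Lemma cmeasurable_lin z f g : cmeasurable f -> cmeasurable g ->
  cmeasurable (fun t => z * f t + g t).
Proof.
by move=> mf mg; exact: (cmeasurableD (f := fun t => z * f t) (cmeasurableZ z mf) mg).
Qed.

Lemma energy_lin z f g : cmeasurable f -> cmeasurable g ->
  (energy (fun t => z * f t + g t)%R <=
   2%:E * ((sqmod z)%:E * energy f) + 2%:E * energy g)%E.
Proof.
move=> mf mg; rewrite -energyZ//.
exact: (energyD (f := fun t => z * f t) (cmeasurableZ z mf) mg).
Qed.

Lemma cL2_lin z f g : cL2 f -> cL2 g -> cL2 (fun t => z * f t + g t).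
Proof.
move=> [mf ef] [mg eg]; split; first exact: cmeasurable_lin.
apply: le_lt_trans (energy_lin z mf mg) _.
have ff : energy f \is a fin_num by rewrite ge0_fin_numE// energy_ge0.
have gf : energy g \is a fin_num by rewrite ge0_fin_numE// energy_ge0.
by rewrite -(fineK ff) -(fineK gf) -!EFinM -EFinD ltry.
Qed.

Lemma cL12_lin z f g : cL12 f -> cL12 g -> cL12 (fun t => z * f t + g t).
Proof.
by move=> [? ?] [? ?]; split; [exact: cintegrable_lin|exact: cL2_lin].
Qed.

Lemma cL2_opp f : cL2 f -> cL2 (fun t => f (- t)).
Proof. by move=> [mf ef]; split; [exact: cmeasurable_opp|rewrite energy_opp]. Qed.

Lemma energyC f g : energy (f \- g) = energy (g \- f).
Proof.
by apply: eq_integral => t _; rewrite /sqmod/= !ReB !ImB; congr EFin; ring.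
Qed.

Lemma energy_dist h f g : cmeasurable f -> cmeasurable g -> cmeasurable h ->
  (energy (f \- g)%R <= 2%:E * energy (f \- h)%R + 2%:E * energy (h \- g)%R)%E.
Proof.
move=> mf mg mh.
have -> : f \- g = (f \- h) \+ (h \- g).
  by apply/funext => t /=; rewrite addrA subrK.
by apply: energyD; exact: cmeasurableB.
Qed.

Lemma cvg0_le (x y : nat -> \bar R) : (forall n, 0 <= x n)%E ->
  (forall n, x n <= y n)%E -> y n @[n --> \oo] --> 0%E -> x n @[n --> \oo] --> 0%E.
Proof.
move=> x0 xy y0; apply: (@squeeze_cvge _ _ _ _ (cst 0%E) _ y) => //.
- by apply: nearW => n; rewrite x0 xy.
- exact: cvg_cst.
Qed.

Lemma cvg0Z (c : R) (x : nat -> \bar R) :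
  x n @[n --> \oo] --> 0%E -> (c%:E * x n)%E @[n --> \oo] --> 0%E.
Proof. by move=> x0; rewrite -[X in _ --> X](mule0 c%:E); apply: cvgeZl. Qed.

Lemma cvg0_lin2 (c d : R) (x y : nat -> \bar R) :
  x n @[n --> \oo] --> 0%E -> y n @[n --> \oo] --> 0%E ->
  (c%:E * x n + d%:E * y n)%E @[n --> \oo] --> 0%E.
Proof.
move=> x0 y0; rewrite -[X in _ --> X](adde0 0%E); by apply: cvgeD => //; exact: cvg0Z.
Qed.

Lemma cvg0_geometric (C : R) : (C / 4 ^+ n)%:E @[n --> \oo] --> 0%E.
Proof.
apply: cvg_EFin; first exact: nearW.
under eq_fun do rewrite -exprVn.
by apply: cvg_geometric; rewrite ger0_norm// invf_lt1// ltr1n.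
Qed.

Lemma cvg_energy_trans (u v : nat -> R -> R[i]) F :
  (forall n, cmeasurable (u n)) -> (forall n, cmeasurable (v n)) -> cmeasurable F ->
  energy (u n \- v n) @[n --> \oo] --> 0%E -> energy (v n \- F) @[n --> \oo] --> 0%E ->
  energy (u n \- F) @[n --> \oo] --> 0%E.
Proof.
move=> mu_ mv mF uv vF.
apply: (cvg0_le _ _ (cvg0_lin2 2 2 uv vF)) => n; first exact: energy_ge0.
exact: energy_dist.
Qed.

Lemma fourier1B f g : cintegrable f -> cintegrable g ->
  fourier1 (f \- g) = fourier1 f \- fourier1 g.
Proof.
move=> if_ ig.
have -> : f \- g = (fun t => - 1 * g t + f t) by apply/funext => t /=; rewrite mulN1r addrC.
by rewrite fourier1_lin//; apply/funext => w /=; rewrite mulN1r addrC.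
Qed.

Lemma cintegrableB f g : cintegrable f -> cintegrable g -> cintegrable (f \- g).
Proof.
move=> if_ ig.
have -> : f \- g = (fun t => - 1 * g t + f t) by apply/funext => t /=; rewrite mulN1r addrC.
exact: cintegrable_lin.
Qed.

Lemma energy_fourier1B f g : cintegrable f -> cintegrable g ->
  (energy (fourier1 f \- fourier1 g)%R <= (4 * pi)%:E * energy (f \- g)%R)%E.
Proof.
by move=> if_ ig; rewrite -fourier1B//; apply: energy_fourier1; exact: cintegrableB.
Qed.

Lemma is_fourierP f F : is_fourier f F <-> [/\ cL2 f, cL2 F &
  forall g : nat -> R -> R[i], (forall n, cL12 (g n)) ->
    energy (g n \- f) @[n --> \oo] --> 0%E ->
    energy (fourier1 (g n) \- F) @[n --> \oo] --> 0%E].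
Proof.
split=> -[/cLfun2P f2 /cLfun2P F2 H]; split=> // g g12 /cvg_cLnorm2P gf; apply/cvg_cLnorm2P.
- by apply: H => // n; have [/cLfun1P ? /cLfun2P ?] := g12 n.
- by apply: H => // n; have [/cLfun1P ? /cLfun2P ?] := g12 n.
Qed.

(** One approximating sequence is enough: any other one approaches it in L^2, and by
    [energy_fourier1B] the transforms of the two then approach each other. *)
Lemma is_fourier_intro (g : nat -> R -> R[i]) f F : cL2 f -> cL2 F ->
  (forall n, cL12 (g n)) -> energy (g n \- f) @[n --> \oo] --> 0%E ->
  energy (fourier1 (g n) \- F) @[n --> \oo] --> 0%E -> is_fourier f F.
Proof.
move=> f2 F2 g12 gf gF; apply/is_fourierP; split; [exact: f2|exact: F2|] => g' g'12 g'f.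
have mF1 (u : nat -> R -> R[i]) : (forall n, cL12 (u n)) -> forall n, cmeasurable (fourier1 (u n)).
  by move=> u12 n; apply: cmeasurable_fourier1; case: (u12 n).
apply: (cvg_energy_trans (mF1 _ g'12) (mF1 _ g12) F2.1 _ gF).
have : energy (g' n \- g n) @[n --> \oo] --> 0%E.
  apply: (cvg0_le _ _ (cvg0_lin2 2 2 g'f gf)) => n; first exact: energy_ge0.
  rewrite [X in (_ <= _ + _ * X)%E]energyC.
  by apply: energy_dist; [exact: cL12_meas|exact: cL12_meas|exact: f2.1].
move=> /(cvg0Z (4 * pi)) g'g; apply: (cvg0_le _ _ g'g) => n; first exact: energy_ge0.
by apply: energy_fourier1B; [case: (g'12 n)|case: (g12 n)].
Qed.

Lemma integrable_sqmod f : cL2 f -> mu.-integrable setT (EFin \o (fun t => sqmod (f t))).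
Proof.
move=> [mf ef]; apply/integrableP; split.
  by apply/measurable_EFinP; exact: measurable_sqmod.
by under eq_integral do rewrite gee0_abs ?lee_fin ?sqmod_ge0//.
Qed.

Definition rmul (m : R -> R) f (t : R) : R[i] := (m t)%:C * f t.

Lemma Re_rmul m f t : complex.Re (rmul m f t) = m t * complex.Re (f t).
Proof. by rewrite /rmul ReM/= mul0r subr0. Qed.

Lemma Im_rmul m f t : complex.Im (rmul m f t) = m t * complex.Im (f t).
Proof. by rewrite /rmul ImM/= mul0r addr0. Qed.

Lemma sqmod_real (x : R) : sqmod x%:C = x ^+ 2.
Proof. by rewrite /sqmod/= expr0n/= addr0. Qed.

Lemma cmeasurable_rmul (m : R -> R) f : measurable_fun setT m -> cmeasurable f ->
  cmeasurable (rmul m f).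
Proof.
move=> mm [mr mi]; split.
- by under eq_fun do rewrite Re_rmul; exact: measurable_funM.
- by under eq_fun do rewrite Im_rmul; exact: measurable_funM.
Qed.

Lemma cL2_rmul (m : R -> R) f : measurable_fun setT m -> (forall t, 0 <= m t <= 1) ->
  cL2 f -> cL2 (rmul m f).
Proof.
move=> mm m01 [mf ef]; split; first exact: cmeasurable_rmul.
apply: le_lt_trans ef; apply: ge0_le_integral => //.
- by move=> t _; rewrite lee_fin sqmod_ge0.
- by apply/measurable_EFinP; apply: measurable_sqmod; exact: cmeasurable_rmul.
- by apply/measurable_EFinP; exact: measurable_sqmod.
- move=> t _; rewrite lee_fin /rmul sqmodM sqmod_real ler_piMl ?sqmod_ge0//.
  by have /andP[m0 m1] := m01 t; rewrite expr_le1.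
Qed.

(** Dominated convergence, as (m_n - 1)^2 <= 1. It serves twice: for truncations in time and for
    Abel weights in frequency. *)
Lemma rmul_cvg (m : nat -> R -> R) f : (forall n, measurable_fun setT (m n)) ->
  (forall n t, 0 <= m n t <= 1) -> (forall t, m n t @[n --> \oo] --> (1 : R)) ->
  cL2 f -> energy (rmul (m n) f \- f) @[n --> \oo] --> 0%E.
Proof.
move=> mm m01 m1 f2; have [mf ef] := f2.
have sqE n t : sqmod ((rmul (m n) f \- f) t) = (m n t - 1) ^+ 2 * sqmod (f t).
  rewrite -sqmod_real -sqmodM; congr sqmod; rewrite /rmul/=.
  by rewrite rmorphB/= mulrBl mul1r.
have meas n : measurable_fun setT (fun t => (sqmod ((rmul (m n) f \- f) t))%:E).
  apply/measurable_EFinP; apply: measurable_sqmod.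
  by apply: cmeasurableB => //; exact: cmeasurable_rmul.
have c1 : {ae mu, forall t, setT t ->
    (sqmod ((rmul (m n) f \- f) t))%:E @[n --> \oo] --> (cst 0%E : R -> \bar R) t}.
  apply: aeW => t _; apply: cvg_EFin; first exact: nearW.
  under eq_fun do rewrite /= sqE.
  have : (m n t - 1) ^+ 2 * sqmod (f t) @[n --> \oo] --> (1 - 1) ^+ 2 * sqmod (f t).
    apply: cvgMr_tmp; under eq_fun do rewrite expr2; rewrite expr2.
    by apply: cvgM; (apply: cvgB; [exact: m1|exact: cvg_cst]).
  by rewrite subrr expr0n mul0r.
have d1 : {ae mu, forall t n, setT t ->
    (`|(sqmod ((rmul (m n) f \- f) t))%:E| <= (sqmod (f t))%:E)%E}.
  apply: aeW => t n _; rewrite gee0_abs ?lee_fin ?sqmod_ge0// sqE.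
  rewrite ler_piMl ?sqmod_ge0//.
  by have /andP[m0 ml1] := m01 n t; nra.
have [_ _] := @dominated_convergence _ _ R mu setT measurableT _ (cst 0%E) _ meas
  (measurable_cst _) c1 (integrable_sqmod f2) d1.
by rewrite integral0.
Qed.

Definition truncation (n : nat) f := rmul (\1_(`[- n%:R, n%:R]%classic)) f.

(** On A one has |a| <= 1 + a^2 <= 1 + b, and constants are integrable there. A separate majorant
    [b] allows [sqmod] to serve for both the real and the imaginary part. *)
Lemma integrable_truncated (A : set R) (a b : R -> R) :
  measurable A -> (mu A < +oo)%E -> measurable_fun setT a ->
  (forall t, a t ^+ 2 <= b t) -> mu.-integrable setT (EFin \o b) ->
  mu.-integrable setT (EFin \o (fun t => \1_A t * a t)).
Proof.
move=> mA Afin ma ab ib.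
have iA : mu.-integrable setT (EFin \o (\1_A : R -> R)).
  apply/integrableP; split; first by apply/measurable_EFinP; exact: measurable_indic.
  have -> : (\int[mu]_t `|(EFin \o \1_A) t| = \int[mu]_t (\1_A t)%:E)%E.
    by apply: eq_integral => t _; rewrite gee0_abs// lee_fin indicE.
  by rewrite integral_indic// setIT.
apply: (le_integrable measurableT _ _ (integrableD_real iA ib)).
  apply/measurable_EFinP; apply: measurable_funM => //; exact: measurable_indic.
move=> t _ /=; rewrite lee_fin.
have b0 : 0 <= b t by apply: le_trans (ab t); exact: sqr_ge0.
have i0 : 0 <= \1_A t :> R by rewrite indicE.
rewrite [leRHS]ger0_norm ?addr_ge0// normrM (ger0_norm i0).
have /= := ab t; rewrite -(real_normK (num_real (a t))).
rewrite indicE; case: (_ \in _) => /=; rewrite ?mul1r ?mul0r ?add0r// => abt.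
by have := sqr_ge0 (`|a t| - 1); nra.
Qed.

Lemma indic01 (A : set R) t : 0 <= (\1_A t : R) <= 1.
Proof. by rewrite indicE; case: (_ \in _); rewrite /= ?lexx ler01. Qed.

Lemma cL12_truncation n f : cL2 f -> cL12 (truncation n f).
Proof.
move=> f2; have [mf ef] := f2; have if2 := integrable_sqmod f2.
pose I : set R := `[- n%:R, n%:R]%classic.
have If : (mu I < +oo)%E.
  by rewrite /I /= lebesgue_measure_itv/=; case: ifP => _; rewrite ltry.
have mI : measurable I by exact: measurable_itv.
split; first split.
- under eq_fun do rewrite Re_rmul.
  apply: (integrable_truncated mI If mf.1 _ if2) => // t.
  by rewrite /sqmod lerDl sqr_ge0.
- under eq_fun do rewrite Im_rmul.
  apply: (integrable_truncated mI If mf.2 _ if2) => // t.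
  by rewrite /sqmod lerDr sqr_ge0.
- exact: (cL2_rmul (measurable_indic mI) (indic01 _) f2).
Qed.

Lemma truncation_cvg f : cL2 f -> energy (truncation n f \- f) @[n --> \oo] --> 0%E.
Proof.
apply: rmul_cvg => [n|n t|t].
- by apply: measurable_indic; exact: measurable_itv.
- exact: indic01.
- apply: cvg_near_cst; exists (Num.truncn `|t|).+1 => // n /= nt.
  rewrite indicE mem_set//= in_itv/= -ler_norml.
  by apply: ltW; apply: lt_le_trans (truncnS_gt _) _; rewrite ler_nat.
Qed.

Lemma cL12_dense f (e : R) : cL2 f -> 0 < e ->
  exists2 g, cL12 g & (energy (g \- f)%R <= e%:E)%E.
Proof.
move=> f2 e0.
have /fine_cvgP[fin /cvgr0Pnorm_le/(_ e e0) ev] := truncation_cvg f2.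
have [n [nfin nle]] : exists n, energy (truncation n f \- f) \is a fin_num /\
    `|fine (energy (truncation n f \- f))| <= e.
  have [N1 _ H1] := fin; have [N2 _ H2] := ev; exists (maxn N1 N2).
  by split; [apply: H1; rewrite /= leq_maxl|apply: H2; rewrite /= leq_maxr].
exists (truncation n f); first exact: cL12_truncation.
by rewrite -(fineK nfin) lee_fin; apply: le_trans (ler_norm _) nle.
Qed.

(** The rate 8^-n is the one that [rapid_L2_limit] asks of the increments. *)
Lemma cL12_rapid_approx f : cL2 f -> exists g : nat -> R -> R[i],
  (forall n, cL12 (g n)) /\ (forall n, (energy (g n \- f)%R <= (8 ^- n)%:E)%E).
Proof.
move=> f2.
have /choice[g gP] : forall n : nat, exists g, cL12 g /\ (energy (g \- f)%R <= (8 ^- n)%:E)%E.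
  move=> n; have [|g g12 gf] := @cL12_dense f (8 ^- n) f2; last by exists g.
  by rewrite invr_gt0 exprn_gt0.
by exists g; split=> n; have [] := gP n.
Qed.

Lemma rapid_cvg f (g : nat -> R -> R[i]) :
  (forall n, (energy (g n \- f)%R <= (8 ^- n)%:E)%E) ->
  energy (g n \- f) @[n --> \oo] --> 0%E.
Proof.
move=> gf; apply: (cvg0_le _ _ (cvg0_geometric 1)) => n; first exact: energy_ge0.
apply: le_trans (gf n) _; rewrite lee_fin mul1r lef_pV2 ?posrE ?exprn_gt0//.
by rewrite lerXn2r ?nnegrE// ler_nat.
Qed.

Lemma is_fourier_exists f : cL2 f -> exists F, is_fourier f F.
Proof.
move=> f2; have [g [g12 gf]] := cL12_rapid_approx f2.
have g1 n : cintegrable (g n) by case: (g12 n).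
pose u n := fourier1 (g n).
have mu_ n : cmeasurable (u n) by exact: cmeasurable_fourier1.
(* The estimate gives 4 pi (2/8 + 2) = 9 pi, rounded up to 16 pi. *)
have ud n : (energy (u n.+1 \- u n)%R <= (16 * pi / 8 ^+ n)%:E)%E.
  apply: le_trans (energy_fourier1B (g1 n.+1) (g1 n)) _.
  apply: (@le_trans _ _ ((4 * pi)%:E * (2%:E * (8 ^- n.+1)%:E + 2%:E * (8 ^- n)%:E))%E).
    rewrite lee_wpmul2l ?lee_fin ?mulr_ge0 ?pi_ge0//.
    apply: le_trans (energy_dist (cL12_meas (g12 n.+1)) (cL12_meas (g12 n)) f2.1) _.
    by rewrite leeD// lee_wpmul2l// energyC.
  rewrite [leLHS](_ : _ = (4 * pi * (2 * 8 ^- n.+1 + 2 * 8 ^- n))%:E)//.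
  rewrite lee_fin exprS invfM.
  have p0 : 0 < 8 ^- n :> R by rewrite invr_gt0 exprn_gt0.
  by have := pi_ge0 R; move: (8 ^- n) p0 => x p0 pi0; nra.
have C0 : 0 <= 16 * pi :> R by rewrite mulr_ge0 ?pi_ge0.
(* [phi] is the real or the imaginary part: completeness was proved for real sequences, so the limit
   is built from two components. *)
have part (phi : R[i] -> R) : (forall z w, phi (z - w) = phi z - phi w) ->
    (forall z, phi z ^+ 2 <= sqmod z) ->
    (forall n, measurable_fun setT (fun t => phi (u n t))) ->
    exists2 A : R -> R, measurable_fun setT A & forall n,
      (\int[mu]_t ((A t - phi (u n t)) ^+ 2)%:E <= (8 * (16 * pi) / 4 ^+ n)%:E)%E.
  move=> phiB phile mphi; apply: (rapid_L2_limit C0 mphi) => n.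
  apply: le_trans (ud n); apply: ge0_le_integral => //.
  - by move=> t _; rewrite lee_fin sqr_ge0.
  - have H : measurable_fun setT (fun t => (phi (u n.+1 t) - phi (u n t)) ^+ 2).
      by apply: measurable_funX; exact: measurable_funB.
    by apply/measurable_EFinP; exact: H.
  - by apply/measurable_EFinP; apply: measurable_sqmod; exact: cmeasurableB.
  - by move=> t _; rewrite lee_fin -phiB.
have [A mA HA] := part _ (@ReB R) (fun z => ltac:(by rewrite /sqmod lerDl sqr_ge0))
  (fun n => (mu_ n).1).
have [B mB HB] := part _ (@ImB R) (fun z => ltac:(by rewrite /sqmod lerDr sqr_ge0))
  (fun n => (mu_ n).2).
pose F t := A t +i* B t.
have mF : cmeasurable F by split.
have uF n : (energy (u n \- F)%R <= (16 * (16 * pi) / 4 ^+ n)%:E)%E.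
  rewrite energyC energyE; last exact: cmeasurableB.
  have -> : (\int[mu]_t (complex.Re ((F \- u n)%R t) ^+ 2)%:E =
      \int[mu]_t ((A t - complex.Re (u n t)) ^+ 2)%:E)%E.
    by apply: eq_integral => t _; rewrite -[A t]/(complex.Re (F t)) -ReB.
  have -> : (\int[mu]_t (complex.Im ((F \- u n)%R t) ^+ 2)%:E =
      \int[mu]_t ((B t - complex.Im (u n t)) ^+ 2)%:E)%E.
    by apply: eq_integral => t _; rewrite -[B t]/(complex.Im (F t)) -ImB.
  apply: le_trans (leeD (HA n) (HB n)) _.
  by rewrite -EFinD lee_fin le_eqVlt; apply/orP; left; apply/eqP; ring.
have F2 : cL2 F.
  split=> //.
  have -> : F = (F \- u 0%N) \+ u 0%N by apply/funext => t /=; rewrite subrK.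
  apply: le_lt_trans (energyD (cmeasurableB mF (mu_ 0%N)) (mu_ 0%N)) _.
  apply: lte_add_pinfty; apply: lte_mul_pinfty => //.
  - by rewrite energyC; apply: le_lt_trans (uF 0%N) _; rewrite ltry.
  - apply: le_lt_trans (energy_fourier1 (g1 0%N)) _.
    apply: lte_mul_pinfty => //; first by rewrite lee_fin mulr_ge0 ?pi_ge0.
    by case: (g12 0%N) => _ [].
exists F; apply: (is_fourier_intro f2 F2 g12 (rapid_cvg gf)).
apply: (cvg0_le _ _ (cvg0_geometric (16 * (16 * pi)))) => n; first exact: energy_ge0.
exact: uF.
Qed.

End L2Fourier.

(** * Linearity, reflection, continuity and uniqueness of the L^2 transform *)

Section Calculus.
Context {R : realType}.
Local Notation mu := (@lebesgue_measure R).
Implicit Types (f g h F G : R -> R[i]) (z : R[i]).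

Lemma is_fourier_cL2 f F : is_fourier f F -> cL2 f /\ cL2 F.
Proof. by case/is_fourierP. Qed.

Lemma is_fourier_approx f F : is_fourier f F -> exists g : nat -> R -> R[i],
  [/\ forall n, cL12 (g n), energy (g n \- f) @[n --> \oo] --> 0%E &
      energy (fourier1 (g n) \- F) @[n --> \oo] --> 0%E].
Proof.
move=> /is_fourierP[f2 F2 H]; have [g [g12 gf]] := cL12_rapid_approx f2.
have gf0 := rapid_cvg gf.
by exists g; split; [exact: g12|exact: gf0|exact: H].
Qed.

Lemma cvg_energy_lin z (u v : nat -> R -> R[i]) f g :
  (forall n, cmeasurable (u n)) -> (forall n, cmeasurable (v n)) ->
  cmeasurable f -> cmeasurable g ->
  energy (u n \- f) @[n --> \oo] --> 0%E -> energy (v n \- g) @[n --> \oo] --> 0%E ->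
  energy ((fun t => z * u n t + v n t) \- (fun t => z * f t + g t)) @[n --> \oo] --> 0%E.
Proof.
move=> mu_ mv mf mg uf vg.
have := cvg0_lin2 2 2 (cvg0Z (sqmod z) uf) vg.
apply: cvg0_le => n; first exact: energy_ge0.
have -> : (fun t => z * u n t + v n t) \- (fun t => z * f t + g t) =
    (fun t => z * (u n \- f) t + (v n \- g) t).
  by apply/funext => t /=; ring.
by apply: energy_lin; exact: cmeasurableB.
Qed.

Lemma is_fourier_lin z f g F G : is_fourier f F -> is_fourier g G ->
  is_fourier (fun t => z * f t + g t) (fun t => z * F t + G t).
Proof.
move=> fF gG; have [f2 F2] := is_fourier_cL2 fF; have [g2 G2] := is_fourier_cL2 gG.
have [u [u12 uf uF]] := is_fourier_approx fF; have [v [v12 vg vG]] := is_fourier_approx gG.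
have mF1 w : cL12 w -> cmeasurable (@fourier1 R w).
  by move=> [w1 _]; exact: cmeasurable_fourier1.
apply: (is_fourier_intro (g := fun n t => z * u n t + v n t)).
- exact: cL2_lin.
- exact: cL2_lin.
- by move=> n; exact: cL12_lin.
- apply: cvg_energy_lin uf vg => [n|n||]; [exact: cL12_meas|exact: cL12_meas| |].
  + by case: f2.
  + by case: g2.
- under eq_fun do rewrite (fourier1_lin z (u12 _).1 (v12 _).1).
  apply: cvg_energy_lin uF vG => [n|n||]; [exact: mF1|exact: mF1| |].
  + by case: F2.
  + by case: G2.
Qed.

Lemma is_fourier_opp f F : is_fourier f F ->
  is_fourier (fun t => f (- t)) (fun t => F (- t)).
Proof.
move=> fF; have [f2 F2] := is_fourier_cL2 fF.
have [u [u12 uf uF]] := is_fourier_approx fF.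
apply: (is_fourier_intro (g := fun n t => u n (- t))).
- exact: cL2_opp.
- exact: cL2_opp.
- by move=> n; split; [apply: cintegrable_opp; case: (u12 n)|apply: cL2_opp; case: (u12 n)].
- under eq_fun => n.
    rewrite (energy_opp (cmeasurableB (cL12_meas (u12 n)) f2.1)); over.
  exact: uf.
- under eq_fun => n.
    have -> : fourier1 (fun t => u n (- t)) \- (fun t => F (- t)) =
        (fun t => (fourier1 (u n) \- F) (- t)).
      by apply/funext => w /=; rewrite fourier1_opp//; case: (u12 n).
    rewrite (energy_opp (cmeasurableB (cmeasurable_fourier1 (u12 n).1) F2.1)); over.
  exact: uF.
Qed.

(* The constant is not optimal: 4 pi for the L^1 bound, times 4 for two uses of
   the quasi-triangle inequality energyD. *)
Lemma is_fourier_bound f F : is_fourier f F -> (energy F <= (16 * pi)%:E * energy f)%E.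
Proof.
move=> fF; have [[mf ef] [mF eF]] := is_fourier_cL2 fF.
have [u [u12 uf uF]] := is_fourier_approx fF.
have ffin : energy f \is a fin_num by rewrite ge0_fin_numE// energy_ge0.
pose y n := (2%:E * energy (fourier1 (u n) \- F)%R + (16 * pi)%:E * energy (u n \- f)%R)%E.
have y0 : y n @[n --> \oo] --> 0%E by exact: cvg0_lin2.
have le n : (energy F <= (16 * pi)%:E * energy f + y n)%E.
  have mu1 := cmeasurable_fourier1 (u12 n).1.
  have b1 : (energy F <= 2%:E * energy (fourier1 (u n) \- F)%R + 2%:E * energy (fourier1 (u n)))%E.
    have -> : F = (F \- fourier1 (u n)) \+ fourier1 (u n) by apply/funext => t /=; rewrite subrK.
    rewrite [X in (_ <= _ * X + _)%E](_ : _ = energy (F \- fourier1 (u n))); last first.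
      rewrite energyC; congr energy; apply/funext => t /=; ring.
    by apply: energyD => //; exact: cmeasurableB.
  have b2 : (energy (u n) <= 2%:E * energy (u n \- f)%R + 2%:E * energy f)%E.
    have {1}-> : u n = (u n \- f) \+ f by apply/funext => t /=; rewrite subrK.
    by apply: energyD => //; apply: cmeasurableB => //; exact: cL12_meas.
  have b3 := energy_fourier1 (u12 n).1.
  apply: le_trans b1 _; rewrite /y addeCA leeD2l//.
  have p4 : (0 <= (4 * pi)%:E :> \bar R)%E by rewrite lee_fin mulr_ge0 ?pi_ge0.
  apply: le_trans (lee_wpmul2l _ (le_trans b3 (lee_wpmul2l p4 b2))) _ => //.
  rewrite ge0_muleDr ?mule_ge0 ?energy_ge0// ge0_muleDr ?mule_ge0 ?energy_ge0//.
  rewrite !muleA -!EFinM addeC.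
  by have -> : 2 * (4 * pi) * 2 = 16 * pi :> R by ring.
have L : ((16 * pi)%:E * energy f + y n)%E @[n --> \oo] --> ((16 * pi)%:E * energy f)%E.
  rewrite -[X in _ --> X]adde0; apply: cvgeD => //; last exact: cvg_cst.
  by rewrite fin_num_adde_defl.
rewrite -(cvg_lim _ L)//; apply: lime_ge; first by apply/cvg_ex; eexists; exact: L.
exact: nearW.
Qed.

(** By linearity F - F' is a transform of f - f, which has energy 0, and [is_fourier_bound]
    transfers this to F - F'. *)
Lemma is_fourier_unique f F F' : is_fourier f F -> is_fourier f F' ->
  energy (F \- F') = 0%E.
Proof.
move=> fF fF'.
have := is_fourier_bound (is_fourier_lin (- 1) fF' fF).
have -> : energy (fun t => - 1 * f t + f t) = 0%E.
  rewrite -[RHS](integral0 mu setT); apply: eq_integral => t _.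
  by rewrite mulN1r addNr /sqmod/= expr0n/= addr0.
rewrite mule0 => le0; apply/eqP; rewrite eq_le energy_ge0 andbT.
have -> // : F \- F' = (fun t => - 1 * F' t + F t).
by apply/funext => t /=; rewrite mulN1r addrC.
Qed.

(** Allows a transform known only to exist to be replaced by an explicit function once the two are
    shown to agree almost everywhere. *)
Lemma is_fourier_energy0 f F F' : is_fourier f F -> cL2 F' ->
  energy (F \- F') = 0%E -> is_fourier f F'.
Proof.
move=> fF F'2 FF'; have [f2 F2] := is_fourier_cL2 fF.
have [u [u12 uf uF]] := is_fourier_approx fF.
apply: (is_fourier_intro f2 F'2 u12 uf).
have c0 : energy (F \- F') @[n --> \oo] --> 0%E by rewrite FF'; exact: cvg_cst.
apply: (cvg0_le _ _ (cvg0_lin2 2 2 uF c0)) => n; first exact: energy_ge0.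
apply: energy_dist; last by case: F2.
- by apply: cmeasurable_fourier1; case: (u12 n).
- by case: F'2.
Qed.

(* The transform of f exists, and by the energy bound it is also the limit of
   the U n. *)
Lemma is_fourier_closed (u U : nat -> R -> R[i]) f F : cL2 f -> cL2 F ->
  (forall n, is_fourier (u n) (U n)) ->
  energy (u n \- f) @[n --> \oo] --> 0%E -> energy (U n \- F) @[n --> \oo] --> 0%E ->
  is_fourier f F.
Proof.
move=> f2 F2 uU uf UF; have [F' fF'] := is_fourier_exists f2.
have [_ F'2] := is_fourier_cL2 fF'.
have U2 n : cL2 (U n) by case: (is_fourier_cL2 (uU n)).
apply: (is_fourier_energy0 fF' F2).
have UF' : energy (U n \- F') @[n --> \oo] --> 0%E.
  apply: (cvg0_le _ _ (cvg0Z (16 * pi) uf)) => n; first exact: energy_ge0.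
  have := is_fourier_bound (is_fourier_lin (- 1) fF' (uU n)).
  have -> : (fun t => - 1 * f t + u n t) = u n \- f.
    by apply/funext => t /=; rewrite mulN1r addrC.
  have -> // : (fun t => - 1 * F' t + U n t) = U n \- F'.
  by apply/funext => t /=; rewrite mulN1r addrC.
have L := cvg0_lin2 2 2 UF' UF.
apply/eqP; rewrite eq_le energy_ge0 andbT.
rewrite -(cvg_lim _ L)//; apply: lime_ge; first by apply/cvg_ex; eexists; exact: L.
apply: nearW => n; rewrite [X in (_ <= _ * X + _)%E]energyC.
by apply: energy_dist; [case: F'2|case: F2|case: (U2 n)].
Qed.

Lemma is_fourier_fourier1 g : cL12 g -> is_fourier g (fourier1 g).
Proof.
move=> [g1 g2].
have z0 (h : R -> R[i]) : energy (h \- h) = 0%E.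
  rewrite -[RHS](integral0 mu setT); apply: eq_integral => t _.
  by rewrite /= subrr /sqmod/= expr0n/= addr0.
apply: (is_fourier_intro (g := fun=> g)) => //.
- split; first exact: cmeasurable_fourier1.
  apply: le_lt_trans (energy_fourier1 g1) _; apply: lte_mul_pinfty => //.
  + by rewrite lee_fin mulr_ge0 ?pi_ge0.
  + by case: g2.
- by rewrite z0; exact: cvg_cst.
- by rewrite z0; exact: cvg_cst.
Qed.

Lemma is_fourier_fourier f : cL2 f -> is_fourier f (fourier f).
Proof.
move=> f2; have [F fF] := is_fourier_exists f2.
exact: (xgetPex (fun=> 0) (ex_intro _ F fF)).
Qed.

End Calculus.

(** * Inversion *)

Section Inversion.
Context {R : realType}.
Local Notation mu := (@lebesgue_measure R).
Implicit Types (a c : R -> R) (x y t : R).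

(** Applied at t + p and t + q: the rescaled primitive of the Poisson kernel tends to a step
    function, and its jump isolates an interval. *)
Lemma cvg_atan_scale (s : R) : s != 0 ->
  atan (n.+1%:R * s) @[n --> \oo] --> Num.sg s * (pi / 2).
Proof.
have pos (r : R) : 0 < r -> atan (n.+1%:R * r) @[n --> \oo] --> (pi / 2 : R).
  move=> r0.
  have -> : (fun n : nat => atan (n.+1%:R * r)) = atan \o (fun n : nat => n.+1%:R * r) by [].
  apply: cvg_comp; last exact: cvgy_atan.
  apply/cvgryPge => A.
  exists (Num.truncn `|A / r|) => // n /= nA.
  rewrite -ler_pdivrMr//; apply: le_trans (ler_norm _) _.
  by apply: ltW; apply: lt_le_trans (truncnS_gt _) _; rewrite ler_nat ltnS.
rewrite neq_lt => /orP[s0|s0]; last by rewrite gtr0_sg// mul1r; exact: pos.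
rewrite ltr0_sg// mulN1r.
have -> : (fun n : nat => atan (n.+1%:R * s)) = (fun n : nat => - atan (n.+1%:R * - s)).
  by apply/funext => n; rewrite mulrN atanN opprK.
by apply: cvgN; apply: pos; rewrite oppr_gt0.
Qed.

(* The convolution of a with the Poisson kernel, evaluated at -x. *)
Definition poisson_int (n : nat) a x := \int[mu]_t (a t * poisson n.+1%:R^-1 (t + x)).

Lemma measurable_poisson_int n a : mu.-integrable setT (EFin \o a) ->
  measurable_fun setT (poisson_int n a).
Proof.
by move=> ia; apply: continuous_measurable_fun; apply: continuous_poisson_integral.
Qed.

Lemma integrable_itv_indic (p q : R) :
  mu.-integrable setT (EFin \o (\1_(`[p, q]%classic) : R -> R)).
Proof.
have mI : measurable (`[p, q]%classic : set R) by exact: measurable_itv.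
apply/integrableP; split; first by apply/measurable_EFinP; exact: measurable_indic.
have -> : (\int[mu]_t `|(EFin \o \1_`[p, q]%classic) t| = \int[mu]_t (\1_`[p, q]%classic t)%:E)%E.
  by apply: eq_integral => t _; rewrite gee0_abs// lee_fin indicE.
rewrite integral_indic// setIT /= lebesgue_measure_itv/=.
by case: ifP => _; rewrite ltry.
Qed.

Lemma poisson_int_bound n a x : mu.-integrable setT (EFin \o a) ->
  `|poisson_int n a x| <= 2 / n.+1%:R^-1 * \int[mu]_t `|a t|.
Proof.
move=> ia; apply: Rintegral_bounded => //.
- by under eq_fun do rewrite addrC; exact: measurable_poisson.
- by move=> t; exact: poisson_le.
Qed.

Lemma poisson_int_itv n a p q : p < q -> mu.-integrable setT (EFin \o a) ->
  \int[mu]_x (\1_(`[p, q]%classic) x * poisson_int n a x) =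
  \int[mu]_t (a t * (2 * (atan (n.+1%:R * (t + q)) - atan (n.+1%:R * (t + p))))).
Proof.
move=> pq ia.
have e0 : 0 < n.+1%:R^-1 :> R by rewrite invr_gt0.
have mK : measurable_fun setT (fun z : R * R => poisson n.+1%:R^-1 (z.2 + z.1)).
  apply: (measurableT_comp (continuous_measurable_fun (continuous_poisson e0))).
  by apply: measurable_funD; [exact: measurable_snd|exact: measurable_fst].
rewrite /poisson_int (Rintegral_exchange (k := fun x t => poisson n.+1%:R^-1 (t + x))
  (M := 2 / n.+1%:R^-1) (integrable_itv_indic p q) ia mK); last first.
  by move=> x t; exact: poisson_le.
apply: eq_Rintegral => t _; congr (_ * _).
have := integral_poisson_itv t e0 pq; rewrite invrK => H.
transitivity (\int[mu]_(x in `[p, q]) poisson n.+1%:R^-1 (t + x)); last by rewrite /Rintegral H.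
rewrite [RHS]Rintegral_mkcond; apply: eq_Rintegral => x _.
by rewrite patchE indicE; case: ifP; rewrite ?mul1r ?mul0r.
Qed.

Lemma poisson_int_itv_cvg a p q : p < q -> mu.-integrable setT (EFin \o a) ->
  \int[mu]_x (\1_(`[p, q]%classic) x * poisson_int n a x) @[n --> \oo] -->
  \int[mu]_x (\1_(`[p, q]%classic) x * (2 * pi * a (- x))).
Proof.
move=> pq ia; have ma := integrable_measurable ia.
pose psi (n : nat) t := 2 * (atan (n.+1%:R * (t + q)) - atan (n.+1%:R * (t + p))).
have psi_le n t : `|psi n t| <= 2 * pi.
  rewrite /psi ler_norml.
  have := atan_ltpi2 (n.+1%:R * (t + q)); have := atan_gtNpi2 (n.+1%:R * (t + q)).
  have := atan_ltpi2 (n.+1%:R * (t + p)); have := atan_gtNpi2 (n.+1%:R * (t + p)).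
  by move=> *; apply/andP; split; lra.
have cpsi n : continuous (psi n).
  move=> t; apply: cvgMl_tmp; apply: cvgB;
  (apply: continuous_comp; last exact: continuous_atan);
  by apply: cvgMl_tmp; apply: cvgD; [exact: cvg_id|exact: cvg_cst].
have mpsi n : measurable_fun setT (psi n) by exact: continuous_measurable_fun.
pose lim t : R := \1_(`[p, q]%classic) (- t) * (2 * pi * a t).
have mlim : measurable_fun setT lim.
  apply: measurable_funM; last exact: measurable_funM.
  by apply: (measurableT_comp _ (@oppr_measurable R setT)); exact: measurable_indic.
have -> : \int[mu]_x (\1_(`[p, q]%classic) x * (2 * pi * a (- x))) = \int[mu]_t lim t.
  rewrite -[RHS]Rintegral_opp//; apply: eq_Rintegral => x _.
  by rewrite /lim opprK.
under eq_fun do rewrite (poisson_int_itv _ pq ia).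
have iapsi n : mu.-integrable setT (EFin \o (fun t => a t * psi n t)).
  exact: (integrableM_bounded (M := 2 * pi)).
(* The arctangent limits are taken away from their jumps, at t = -p and t = -q. *)
have ne r : {ae mu, forall t, t <> r}.
  exists [set r]; split; [exact: measurable_set1|exact: lebesgue_measure_set1|].
  by move=> t /= /contrapT ->.
have c1 : {ae mu, forall t, setT t ->
    (a t * psi n t)%:E @[n --> \oo] --> ((lim t)%:E : \bar R)}.
  move: (ne (- p)) (ne (- q)).
  apply: (@filterS2 _ _ (ae_filter_ringOfSetsType mu)) => t tp tq _.
  apply: cvg_EFin; first exact: nearW.
  have p0 : t + p != 0 by rewrite addr_eq0; exact/eqP.
  have q0 : t + q != 0 by rewrite addr_eq0; exact/eqP.
  (* The two signs differ exactly when -t lies strictly between p and q; there the bracket is pi/2 +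
     pi/2, whence the factor 2 pi. Otherwise they cancel. *)
  have -> : lim t = a t * (2 * (Num.sg (t + q) * (pi / 2) - Num.sg (t + p) * (pi / 2))).
    rewrite /lim indicE; have [pt|tp0] := ltP 0 (t + p).
      rewrite memNset; last by rewrite /= in_itv/=; lra.
      by rewrite (gtr0_sg pt) gtr0_sg /=; [ring|lra].
    have {}tp0 : t + p < 0 by rewrite lt_neqAle p0.
    have [qt|tq0] := ltP 0 (t + q).
      rewrite mem_set; last by rewrite /= in_itv/=; lra.
      by rewrite (ltr0_sg tp0) (gtr0_sg qt) /=; field.
    have {}tq0 : t + q < 0 by rewrite lt_neqAle q0.
    rewrite memNset; last by rewrite /= in_itv/=; lra.
    by rewrite (ltr0_sg tp0) (ltr0_sg tq0) /=; ring.
  by apply: cvgMl_tmp; apply: cvgMl_tmp; apply: cvgB; exact: cvg_atan_scale.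
have ib : mu.-integrable setT (fun t => (2 * pi * `|a t|)%:E).
  by apply: (integrableZ_real (2 * pi)); exact: integrable_norm.
have d1 : {ae mu, forall t n, setT t -> (`|(a t * psi n t)%:E| <= (2 * pi * `|a t|)%:E)%E}.
  by apply: aeW => t n _; rewrite /= lee_fin normrM mulrC ler_wpM2r.
have me n : measurable_fun setT (fun t => (a t * psi n t)%:E).
  by apply/measurable_EFinP; exact: measurable_funM.
have ml : measurable_fun setT (fun t => (lim t)%:E) by exact/measurable_EFinP.
have [il _ H] := @dominated_convergence _ _ R mu setT measurableT _ _ _ me ml c1 ib d1.
apply: fine_cvg; rewrite /Rintegral fineK; last exact: integrable_fin_num.
exact: H.
Qed.

Lemma young_le (d r : R) : 0 < d -> 0 <= r -> r <= d + d^-1 * r ^+ 2.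
Proof.
move=> d0 r0; have dn0 : d != 0 by rewrite gt_eqF.
have : 0 <= d^-1 * (r - d) ^+ 2 by rewrite mulr_ge0 ?sqr_ge0 ?invr_ge0 ?(ltW d0).
have -> : d^-1 * (r - d) ^+ 2 = d + d^-1 * r ^+ 2 - 2 * r by field.
by move: (d^-1 * r ^+ 2) => X; lra.
Qed.

(* Young: |r| <= d + r^2 / d on [p, q], with d small compared to the length. *)
Lemma itv_pairing_cvg (u : nat -> R -> R) (gam : R -> R) p q :
  (forall n, mu.-integrable setT (EFin \o (fun x => \1_(`[p, q]%classic) x * u n x))) ->
  (forall n, measurable_fun setT (u n)) -> measurable_fun setT gam ->
  mu.-integrable setT (EFin \o (fun x => \1_(`[p, q]%classic) x * gam x)) ->
  (\int[mu]_x ((u n x - gam x) ^+ 2)%:E)%E @[n --> \oo] --> 0%E ->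
  \int[mu]_x (\1_(`[p, q]%classic) x * u n x) @[n --> \oo] -->
  \int[mu]_x (\1_(`[p, q]%classic) x * gam x).
Proof.
move=> iu mu_ mg ig /fine_cvgP[ufin ucvg].
pose m := \int[mu]_x (\1_(`[p, q]%classic) x : R).
have m0 : 0 <= m by apply: Rintegral_ge0 => x _; rewrite indicE.
apply/cvgrPdist_le => e e0.
(* With squared distance at most d^2, the Young bound integrates to d m + d = d (m + 1) = e. *)
pose d := e / (m + 1).
have d0 : 0 < d by rewrite divr_gt0// ltr_wpDl.
have /cvgr0Pnorm_le/(_ (d ^+ 2) (exprn_gt0 _ d0)) ev := ucvg.
near=> n.
have nfin : (\int[mu]_x ((u n x - gam x) ^+ 2)%:E)%E \is a fin_num by near: n.
have nle : `|fine (\int[mu]_x ((u n x - gam x) ^+ 2)%:E)%E| <= d ^+ 2 by near: n.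
have mug : measurable_fun setT (fun x => (u n x - gam x) ^+ 2).
  by apply: measurable_funX; exact: measurable_funB.
have i2 : mu.-integrable setT (EFin \o (fun x => (u n x - gam x) ^+ 2)).
  apply/integrableP; split; first exact/measurable_EFinP.
  under eq_integral do rewrite gee0_abs ?lee_fin ?sqr_ge0//.
  by rewrite -ge0_fin_numE// integral_ge0// => x _; rewrite lee_fin sqr_ge0.
have iJ := integrable_itv_indic p q.
rewrite distrC -RintegralB//; apply: le_trans (le_normr_Rintegral _ _) _ => //.
  by have := integrableB measurableT (iu n) ig.
apply: (@le_trans _ _ (\int[mu]_x (d * \1_(`[p, q]%classic) x + d^-1 * (u n x - gam x) ^+ 2))).
  apply: le_Rintegral => //.
  - by apply: integrable_norm; have := integrableB measurableT (iu n) ig.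
  - by apply: integrableD_real; exact: integrableZ_real.
  - move=> x _; rewrite -mulrBr.
    rewrite -(real_normK (num_real (u n x - gam x))); set r := `|u n x - gam x|.
    rewrite normrM -/r indicE; case: (_ \in _) => /=.
    + by rewrite normr1 mul1r mulr1 young_le// normr_ge0.
    + by rewrite normr0 mul0r mulr0 add0r mulr_ge0 ?invr_ge0 ?(ltW d0) ?sqr_ge0.
rewrite RintegralD//; [|exact: integrableZ_real|exact: integrableZ_real].
rewrite !RintegralZl// -/m.
have : \int[mu]_x ((u n x - gam x) ^+ 2) <= d ^+ 2 by apply: le_trans (ler_norm _) nle.
move=> H; apply: (@le_trans _ _ (d * m + d^-1 * d ^+ 2)).
  by rewrite lerD2l ler_wpM2l// invr_ge0 ltW.
by rewrite expr2 mulrA mulVf ?gt_eqF// mul1r -{2}[d]mulr1 -mulrDr /d divfK// gt_eqF// ltr_wpDl.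
Unshelve. all: by end_near. Qed.

(** Lebesgue differentiation: the primitive of [gam] from -N vanishes identically, and almost
    everywhere to the right of -N its derivative is [gam]. Countably many N cover the line. *)
Lemma itv_integral0_ae (gam : R -> R) : measurable_fun setT gam ->
  (forall p q, mu.-integrable setT (EFin \o (fun x => \1_(`[p, q]%classic) x * gam x))) ->
  (forall p q, p < q -> \int[mu]_x (\1_(`[p, q]%classic) x * gam x) = 0) ->
  {ae mu, forall x, gam x = 0}.
Proof.
move=> mg ig g0.
have Eint p q : \int[mu]_(x in `[p, q]) gam x = \int[mu]_x (\1_(`[p, q]%classic) x * gam x).
  rewrite Rintegral_mkcond; apply: eq_Rintegral => x _.
  by rewrite patchE indicE; case: ifP; rewrite ?mul1r ?mul0r.
have ig' p q : mu.-integrable `[p, q]%classic (EFin \o gam).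
  have mI : measurable (`[p, q]%classic : set R) by exact: measurable_itv.
  have := @integrableS _ _ R mu setT `[p, q]%classic _ measurableT mI (@subsetT _ _) (ig p q).
  apply: eq_integrable => // x xI.
  by rewrite /= indicE xI mul1r.
have loc : locally_integrable setT gam.
  split => //; first exact: openT.
  move=> K _ cK.
  have [M [_ HM]] := compact_bounded cK.
  have KI : K `<=` `[- (`|M| + 1), `|M| + 1]%classic.
    move=> x Kx /=; rewrite in_itv/= -ler_norml; apply: HM => //.
    by rewrite (le_lt_trans (ler_norm _))// ltrDl.
  have := @integrableS _ _ R mu _ K _ (measurable_itv _) (compact_measurable cK) KI
    (ig' (- (`|M| + 1)) (`|M| + 1)).
  by case/integrableP.
have H (N : nat) : {ae mu, forall x, - N%:R < x -> gam x = 0}.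
  have /= := FTC1 (f := gam) (a := BLeft (- N%:R)) (fun y => ig' _ y) loc.
  apply: (@filterS _ _ (ae_filter_ringOfSetsType mu)) => x + Nx.
  (* For y <= -N the interval is a point or empty, so the primitive is constant on the whole line
     and its derivative can be read off. *)
  have F0 : (fun x : R => \int[mu]_(t in `[- N%:R, x]) gam t) = cst 0.
    apply/funext => y; have [Ny|] := ltP (- N%:R) y; first by rewrite Eint g0.
    rewrite le_eqVlt => /predU1P[->|yN]; first by rewrite set_itv1 Rintegral_set1.
    by rewrite set_itv_ge ?Rintegral_set0// -leNgt bnd_simp.
  by rewrite F0 lte_fin => /(_ Nx)[_ <-]; rewrite derive1_cst.
have := ae_foralln H.
apply: (@filterS _ _ (ae_filter_ringOfSetsType mu)) => x /(_ (Num.truncn `|x|).+1).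
by apply; rewrite ltrNl; apply: le_lt_trans (ler_norm _) _; rewrite normrN truncnS_gt.
Qed.

(** On each interval the same integrals have two limits: that of [gam], by L^2 convergence, and that
    of 2 pi a(-x), by [poisson_int_itv_cvg]. The majorant [b] makes [gam] integrable on
    intervals. *)
Lemma poisson_int_limit a (gam b : R -> R) : mu.-integrable setT (EFin \o a) ->
  measurable_fun setT gam -> (forall x, gam x ^+ 2 <= b x) ->
  mu.-integrable setT (EFin \o b) ->
  (\int[mu]_x ((poisson_int n a x - gam x) ^+ 2)%:E)%E @[n --> \oo] --> 0%E ->
  {ae mu, forall x, gam x = 2 * pi * a (- x)}.
Proof.
move=> ia mg gb ib ug; have ma := integrable_measurable ia.
have iao : mu.-integrable setT (EFin \o (fun x => 2 * pi * a (- x))).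
  by apply: integrableZ_real; exact: integrable_opp.
have mao := integrable_measurable iao.
have mI p q : measurable (`[p, q]%classic : set R) by exact: measurable_itv.
have Ifin p q : (mu `[p, q]%classic < +oo)%E.
  by rewrite /= lebesgue_measure_itv/=; case: ifP => _; rewrite ltry.
have ig p q : mu.-integrable setT (EFin \o (fun x => \1_(`[p, q]%classic) x * gam x)).
  exact: (integrable_truncated (mI p q) (Ifin p q) mg gb ib).
have ia' p q : mu.-integrable setT
    (EFin \o (fun x => \1_(`[p, q]%classic) x * (2 * pi * a (- x)))).
  have -> : (fun x => \1_(`[p, q]%classic) x * (2 * pi * a (- x))) =
      (fun x => 2 * pi * a (- x) * \1_(`[p, q]%classic) x).
    by apply/funext => x; rewrite mulrC.
  apply: (integrableM_bounded (M := 1) iao (measurable_indic (mI p q))) => x.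
  by have /andP[i0 i1] := indic01 `[p, q]%classic x; rewrite ger0_norm.
have iu p q n : mu.-integrable setT
    (EFin \o (fun x => \1_(`[p, q]%classic) x * poisson_int n a x)).
  apply: (integrableM_bounded (integrable_itv_indic p q)).
  - exact: measurable_poisson_int.
  - by move=> x; exact: poisson_int_bound.
have Eb p q : p < q -> \int[mu]_x (\1_(`[p, q]%classic) x * gam x) =
    \int[mu]_x (\1_(`[p, q]%classic) x * (2 * pi * a (- x))).
  move=> pq.
  have c1 := itv_pairing_cvg (iu p q) (fun n => measurable_poisson_int n ia) mg (ig p q) ug.
  have c2 := poisson_int_itv_cvg pq ia.
  by rewrite -(cvg_lim _ c1)// -(cvg_lim _ c2).
have md : measurable_fun setT (fun x => gam x - 2 * pi * a (- x)) by exact: measurable_funB.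
have dE p q : (fun x => \1_(`[p, q]%classic) x * (gam x - 2 * pi * a (- x))) =
    (fun x => \1_(`[p, q]%classic) x * gam x - \1_(`[p, q]%classic) x * (2 * pi * a (- x))).
  by apply/funext => x; rewrite mulrBr.
have := itv_integral0_ae md.
have h1 p q : mu.-integrable setT
    (EFin \o (fun x => \1_(`[p, q]%classic) x * (gam x - 2 * pi * a (- x)))).
  by rewrite dE; exact: (integrableB measurableT (ig p q) (ia' p q)).
move=> /(_ h1) h; have {}h : {ae mu, forall x, gam x - 2 * pi * a (- x) = 0}.
  by apply: h => p q pq; rewrite dE RintegralB// Eb// subrr.
move: h; apply: (@filterS _ _ (ae_filter_ringOfSetsType mu)) => x /eqP.
by rewrite subr_eq0 => /eqP.
Qed.

End Inversion.

(** * Inversion for complex-valued functions, on L^1 and L^2 and then on L^2 *)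

Section ComplexInversion.
Context {R : realType}.
Local Notation mu := (@lebesgue_measure R).
Local Notation cosT := (osc (@cos R)).
Local Notation sinT := (osc (@sin R)).
Implicit Types (f g F G : R -> R[i]).

Lemma fourier1_bound g : cintegrable g -> exists M : R, forall w,
  `|complex.Re (fourier1 g w)| <= M /\ `|complex.Im (fourier1 g w)| <= M.
Proof.
move=> ig; have [ia ib] := ig.
exists (\int[mu]_t `|complex.Re (g t)| + \int[mu]_t `|complex.Im (g t)|) => w.
have ca := osc_bound (@continuous_cos R) (@cos_norm_le1 R) w ia.
have sa := osc_bound (@continuous_sin R) (@sin_norm_le1 R) w ia.
have cb := osc_bound (@continuous_cos R) (@cos_norm_le1 R) w ib.
have sb := osc_bound (@continuous_sin R) (@sin_norm_le1 R) w ib.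
rewrite fourier1E//=; split.
- by apply: le_trans (ler_normD _ _) _; exact: lerD.
- by apply: le_trans (ler_normB _ _) _; rewrite addrC; exact: lerD.
Qed.

(** The transform of g is bounded and in L^2 but may fail to be integrable; the weight restores
    integrability, so that [fourier1] can be applied a second time. *)
Lemma abel_fourier1_cL12 e g : 0 < e -> cL12 g -> cL12 (rmul (abel e) (fourier1 g)).
Proof.
move=> e0 g12; have [g1 g2] := g12.
have [mr mi] := cmeasurable_fourier1 g1; have [M HM] := fourier1_bound g1.
have ie := integrable_abel e0.
split; first split.
- under eq_fun do rewrite Re_rmul.
  by apply: (integrableM_bounded (M := M)) => // w; case: (HM w).
- under eq_fun do rewrite Im_rmul.
  by apply: (integrableM_bounded (M := M)) => // w; case: (HM w).
- apply: cL2_rmul; first exact: measurable_abel.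
  + by move=> t; rewrite (ltW (abel_gt0 _ _)) abel_le1// ltW.
  + by case: (is_fourier_cL2 (is_fourier_fourier1 g12)).
Qed.

(** In the real part of the double transform, the terms from Re g form [abel_cos_poisson] and those
    from Im g form [abel_sin_poisson]; in the imaginary part the roles are exchanged. The vanishing
    sine integrals are inserted first, so that integrands can be compared pointwise. *)
Lemma fourier1_abel_fourier1 n g x : cL12 g ->
  fourier1 (rmul (abel n.+1%:R^-1) (fourier1 g)) x =
  poisson_int n (fun t => complex.Re (g t)) x +i*
  poisson_int n (fun t => complex.Im (g t)) x.
Proof.
move=> g12; have [g1 g2] := g12; have [ia ib] := g1.
have e0 : 0 < n.+1%:R^-1 :> R by rewrite invr_gt0.
rewrite fourier1E; last by have [] := abel_fourier1_cL12 e0 g12.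
rewrite /poisson_int -!abel_cos_poisson//.
have sa0 := abel_sin_poisson x e0 ia; have sb0 := abel_sin_poisson x e0 ib.
set a := (fun t => complex.Re (g t)) in ia sa0 *.
set b := (fun t => complex.Im (g t)) in ib sb0 *.
have prod (phi psi : R -> R) (c : R -> R) : continuous phi -> (forall y, `|phi y| <= 1) ->
    continuous psi -> (forall y, `|psi y| <= 1) -> mu.-integrable setT (EFin \o c) ->
    mu.-integrable setT (EFin \o (fun w => abel n.+1%:R^-1 w * (osc phi c w * psi (w * x)))).
  move=> cphi phi1 cpsi psi1 ic.
  apply: (integrableM_bounded (M := \int[mu]_t `|c t|)); first exact: integrable_abel.
  - apply: measurable_funM; first exact: measurable_osc.
    by under eq_fun do rewrite mulrC; exact: measurable_scale.
  - move=> w; rewrite normrM -[leRHS]mulr1 ler_pM//; exact: osc_bound.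
have cc := @continuous_cos R; have cs := @continuous_sin R.
have c1 := @cos_norm_le1 R; have s1 := @sin_norm_le1 R.
have [[ivr ivi] _] := abel_fourier1_cL12 e0 g12.
have prodB (p q : R -> R) :
    mu.-integrable setT (EFin \o (fun w => abel n.+1%:R^-1 w * p w)) ->
    mu.-integrable setT (EFin \o (fun w => abel n.+1%:R^-1 w * q w)) ->
    mu.-integrable setT (EFin \o (fun w => abel n.+1%:R^-1 w * (p w - q w))).
  move=> ip iq; have := integrableB measurableT ip iq; congr integrable.
  by apply/funext => w; rewrite /= mulrBr.
have prodD (p q : R -> R) :
    mu.-integrable setT (EFin \o (fun w => abel n.+1%:R^-1 w * p w)) ->
    mu.-integrable setT (EFin \o (fun w => abel n.+1%:R^-1 w * q w)) ->
    mu.-integrable setT (EFin \o (fun w => abel n.+1%:R^-1 w * (p w + q w))).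
  move=> ip iq; have := integrableD measurableT ip iq; congr integrable.
  by apply/funext => w; rewrite /= mulrDr.
congr (_ +i* _).
- rewrite -[RHS]addr0 -[X in _ = _ + X]sb0 [in LHS]/osc -[LHS]RintegralD//; first last.
  + exact: (integrable_osc cs s1).
  + exact: (integrable_osc cc c1).
  rewrite -[RHS]RintegralD//; first last.
  + by apply: prodD; exact: prod.
  + by apply: prodB; exact: prod.
  by apply: eq_Rintegral => w _; rewrite Re_rmul Im_rmul fourier1E//= -/a -/b ![x * w]mulrC; ring.
- rewrite -[RHS]subr0 -[X in _ = _ - X]sa0 [in LHS]/osc -[LHS]RintegralB//; first last.
  + exact: (integrable_osc cs s1).
  + exact: (integrable_osc cc c1).
  rewrite -[RHS]RintegralB//; first last.
  + by apply: prodD; exact: prod.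
  + by apply: prodB; exact: prod.
  by apply: eq_Rintegral => w _; rewrite Re_rmul Im_rmul fourier1E//= -/a -/b ![x * w]mulrC; ring.
Qed.

Lemma inversion_cL12 g : cL12 g ->
  is_fourier (fourier1 g) (fun t => (2 * pi)%:C * g (- t)).
Proof.
move=> g12; have [g1 g2] := g12; have [ia ib] := g1.
have [_ ghat2] := is_fourier_cL2 (is_fourier_fourier1 g12).
(* [G] is at first an abstract limit. Since [v n] approximates [fourier1 g], the definition of
   [is_fourier] makes the Poisson integrals converge to [G] in L^2, which is what
   [poisson_int_limit] needs to identify it. *)
have [G hG] := is_fourier_exists ghat2; have [_ G2] := is_fourier_cL2 hG.
have /is_fourierP[_ _ H] := hG.
pose v n := rmul (abel n.+1%:R^-1) (fourier1 g).
have e0 (n : nat) : 0 < n.+1%:R^-1 :> R by rewrite invr_gt0.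
have v12 n : cL12 (v n) by exact: abel_fourier1_cL12.
have vc : energy (v n \- fourier1 g) @[n --> \oo] --> 0%E.
  apply: (rmul_cvg _ _ _ ghat2).
  - by move=> n; exact: measurable_abel.
  - by move=> n t; rewrite (ltW (abel_gt0 _ _)) abel_le1// ltW.
  - by move=> t; exact: cvg_abel.
have vG := H v v12 vc.
have mv n : cmeasurable (fourier1 (v n) \- G).
  by apply: cmeasurableB; [apply: cmeasurable_fourier1; case: (v12 n)|case: G2].
have iG := integrable_sqmod G2.
have gr : {ae mu, forall x, complex.Re (G x) = 2 * pi * complex.Re (g (- x))}.
  apply: (poisson_int_limit (a := fun t => complex.Re (g t)) ia G2.1.1 _ iG).
    by move=> x; rewrite /sqmod lerDl sqr_ge0.
  apply: (cvg0_le _ _ vG) => n.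
    by apply: integral_ge0 => x _; rewrite lee_fin sqr_ge0.
  rewrite energyE//.
  have -> : (\int[mu]_t (complex.Re ((fourier1 (v n) \- G)%R t) ^+ 2)%:E =
    \int[mu]_x ((poisson_int n (fun t => complex.Re (g t)) x - complex.Re (G x)) ^+ 2)%:E)%E.
    by apply: eq_integral => x _; rewrite /= fourier1_abel_fourier1// ReB.
  by rewrite leeDl// integral_ge0// => x _; rewrite lee_fin sqr_ge0.
have gi : {ae mu, forall x, complex.Im (G x) = 2 * pi * complex.Im (g (- x))}.
  apply: (poisson_int_limit (a := fun t => complex.Im (g t)) ib G2.1.2 _ iG).
    by move=> x; rewrite /sqmod lerDr sqr_ge0.
  apply: (cvg0_le _ _ vG) => n.
    by apply: integral_ge0 => x _; rewrite lee_fin sqr_ge0.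
  rewrite energyE//.
  have -> : (\int[mu]_t (complex.Im ((fourier1 (v n) \- G)%R t) ^+ 2)%:E =
    \int[mu]_x ((poisson_int n (fun t => complex.Im (g t)) x - complex.Im (G x)) ^+ 2)%:E)%E.
    by apply: eq_integral => x _; rewrite /= fourier1_abel_fourier1// ImB.
  by rewrite leeDr// integral_ge0// => x _; rewrite lee_fin sqr_ge0.
have mg' : cmeasurable (fun t => (2 * pi)%:C * g (- t)).
  exact: (cmeasurableZ (2 * pi)%:C (cmeasurable_opp g2.1)).
apply: (is_fourier_energy0 hG).
- split=> //; rewrite energyZ; last by apply: cmeasurable_opp; case: g2.
  apply: lte_mul_pinfty => //; first by rewrite lee_fin sqmod_ge0.
  by rewrite energy_opp; case: g2.
- apply: ae_energy0 => //; first by case: G2.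
  move: gr gi; apply: (@filterS2 _ _ (ae_filter_ringOfSetsType mu)) => x xr xi _.
  by apply: complexP; rewrite ?ReM ?ImM/= mul0r ?subr0 ?addr0.
Qed.

(** Inversion holds along an approximating sequence, and reflection and scaling are continuous in
    energy, so [is_fourier_closed] passes to the limit. *)
Lemma inversion_L2 f F : is_fourier f F ->
  is_fourier F (fun t => (2 * pi)%:C * f (- t)).
Proof.
move=> fF; have [f2 F2] := is_fourier_cL2 fF; have [mf ef] := f2.
have [u [u12 uf uF]] := is_fourier_approx fF.
apply: (is_fourier_closed F2 _ (fun n => inversion_cL12 (u12 n)) uF).
- split; first exact: (cmeasurableZ (2 * pi)%:C (cmeasurable_opp mf)).
  rewrite energyZ; last exact: cmeasurable_opp.
  by apply: lte_mul_pinfty; rewrite ?lee_fin ?sqmod_ge0// energy_opp.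
- apply: (cvg0_le _ _ (cvg0Z (sqmod (2 * pi)%:C) uf)) => n; first exact: energy_ge0.
  have -> : (fun t => (2 * pi)%:C * u n (- t)) \- (fun t => (2 * pi)%:C * f (- t)) =
      (fun t => (2 * pi)%:C * (fun t => (u n \- f) (- t)) t).
    by apply/funext => t /=; rewrite mulrBr.
  have md : cmeasurable (u n \- f) by apply: cmeasurableB => //; exact: cL12_meas.
  by rewrite energyZ ?energy_opp//; exact: cmeasurable_opp.
Qed.

End ComplexInversion.

(** * Even parts and the invariant function *)

Section EvenPart.
Context {R : realType}.
Implicit Types (f F : R -> R[i]).

Lemma is_fourier_even f F : is_fourier f F ->
  is_fourier (even_part f) (even_part F).
Proof.
move=> fF.
(* The half of f(t) is written -1/2 f(t) + f(t) to fit the pattern z f + g of the linearity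
   lemma. *)
have := is_fourier_lin 2^-1 (is_fourier_opp fF) (is_fourier_lin (- 2^-1) fF fF).
have E (h : R -> R[i]) :
    (fun t => 2^-1 * h (- t) + (- 2^-1 * h t + h t)) = even_part h.
  by apply/funext => t; rewrite /even_part; field.
by rewrite !E.
Qed.

End EvenPart.

Theorem proposition1 (R : realType) (f : R -> R[i]) (hf : cLfun 2%:E f) :
  let F := fourier f in
  let h := fun t : R =>
    (Num.sqrt (2 * pi))%:C * even_part f t + even_part F t in
  fourier_invariant h /\
  fourier h = (fun omega => (Num.sqrt (2 * pi))%:C * h omega)
    %[ae @lebesgue_measure R].
Proof.
move=> F h.
suff H : fourier h = (fun omega => (Num.sqrt (2 * pi))%:C * h omega)
    %[ae @lebesgue_measure R].
  by split=> //; exists (Num.sqrt (2 * pi))%:C.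
have fF : is_fourier f F by apply: is_fourier_fourier; apply/cLfun2P.
have ef := is_fourier_even fF; have eF := is_fourier_even (inversion_L2 fF).
have hH := is_fourier_lin (Num.sqrt (2 * pi))%:C ef eF.
(* With s = sqrt(2 pi), the transform of h is s E{F} + s^2 E{f}, and s factors out. *)
have HE : (fun t => (Num.sqrt (2 * pi))%:C * even_part F t +
    even_part (fun t => (2 * pi)%:C * f (- t)) t) =
    (fun t => (Num.sqrt (2 * pi))%:C * h t).
  have S : (Num.sqrt (2 * pi))%:C * (Num.sqrt (2 * pi))%:C = (2 * pi)%:C :> R[i].
    apply: complexP; rewrite ?ReM ?ImM/= ?mulr0 ?mul0r ?subr0 ?addr0//.
    by rewrite -expr2 sqr_sqrtr// mulr_ge0 ?pi_ge0.
  apply/funext => t; rewrite [RHS]mulrDr [X in _ = X + _]mulrA S.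
  rewrite [LHS]addrC; congr (_ + _).
  (* The even part is unchanged by the reflection that inversion introduces. *)
  by rewrite /even_part opprK -mulrDr mulrCA [f t + _]addrC.
rewrite HE in hH.
have [h2 H2] := is_fourier_cL2 hH.
have hh := is_fourier_fourier h2.
have [_ hh2] := is_fourier_cL2 hh.
(* [fourier h] is a chosen representative, so it is compared with the computed transform through
   uniqueness, almost everywhere. *)
by apply: energy0_ae; [case: hh2|case: H2|exact: is_fourier_unique hh hH].
Qed.
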